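(* For every word $w$ in the letters $x,y$ and every $z\in\mathbb C\setminus((-\infty,0]\cup[1,\infty))$, $$\sum_{w_1w_2=w}\mathrm{Li}(\tau(w_1);1-z)\,\mathrm{Li}(w_2;z)=\widehat\zeta(\mathrm{reg}(w)),$$ where the sum is over all factorizations $w=w_1w_2$ into (possibly empty) words $w_1,w_2$.
   Context: Let $\mathfrak h=\mathbb C\langle x,y\rangle$ be the non-commutative polynomial algebra, with shuffle product $\sqcup\!\sqcup$ defined bilinearly by $1\sqcup\!\sqcup w=w\sqcup\!\sqcup 1=w$ and $l_1w_1\sqcup\!\sqcup l_2w_2=l_1(w_1\sqcup\!\sqcup l_2w_2)+l_2(l_1w_1\sqcup\!\sqcup w_2)$ for letters $l_1,l_2$ and words $w,w_1,w_2$. Put $\mathfrak h^1=\mathbb C1\oplus\mathfrak hy$ and $\mathfrak h^0=\mathbb C1\oplus x\mathfrak hy$. With the shuffle product one has polynomial algebra decompositions $\mathfrak h=\mathfrak h^1[x]=\mathfrak h^0[x,y]$. $\mathrm{reg}:\mathfrak h=\mathfrak h^0[x,y]\to\mathfrak h^0$ takes an element to its constant term with respect to the decomposition as shuffle polynomials in $x,y$ over $\mathfrak h^0$. $\widehat\zeta:\mathfrak h^0\to\mathbb C$ is the linear map with $\widehat\zeta(1)=1$ and $\widehat\zeta(x^{k_1-1}y\cdots x^{k_m-1}y)=\zeta(k_1,\dots,k_m)=\sum_{n_1>\dots>n_m>0}\frac1{n_1^{k_1}\cdots n_m^{k_m}}$ ($k_1\ge2$). $\tau:\mathfrak h\to\mathfrak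 h$ is the anti-involution (linear, reversing concatenation products) with $\tau(x)=y$, $\tau(y)=x$. Let $D=\mathbb C\setminus((-\infty,0]\cup[1,\infty))$. For $w=x^{k_1-1}y\cdots x^{k_m-1}y\in\mathfrak h^1$, $\mathrm{Li}(w;z)=\sum_{n_1>\dots>n_m>0}\frac{z^{n_1}}{n_1^{k_1}\cdots n_m^{k_m}}$ for $|z|<1$, analytically continued to $D$ (by iterated integrals from $0$); $\mathrm{Li}(1;z)=1$; $\mathrm{Li}(x;z)=\log z$ (principal branch). $\mathrm{Li}(\bullet;z)$ is extended to all of $\mathfrak h$ as the unique linear map which is a homomorphism for the shuffle product. *)

(* Defs.v *)
From HB Require Import structures.
From Stdlib Require Import Reals Epsilon.
From Coquelicot Require Import Coquelicot.
From mathcomp Require Import all_boot all_order all_algebra finmap.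
From mathcomp.multinomials Require Import monalg.
From mathcomp Require Import Rstruct.

Set Implicit Arguments.
Unset Strict Implicit.
Unset Printing Implicit Defensive.

Import Order.TTheory GRing.Theory Num.Theory.
Local Open Scope ring_scope.

(* Coquelicot's complex numbers as a MathComp field, so that they can serve as
   coefficients of a monoid algebra. *)
HB.instance Definition _ := Choice.copy C (R * R)%type.

HB.instance Definition _ := GRing.isZmodule.Build C
  Cplus_assoc Cplus_comm Cplus_0_l
  (fun z => etrans (Cplus_comm _ _) (Cplus_opp_r z)).

Fact C_one_neq0 : RtoC R1 != RtoC R0.
Proof. by apply/eqP; exact: C1_nz. Qed.

HB.instance Definition _ := GRing.Zmodule_isComNzRing.Build C
  Cmult_assoc Cmult_comm Cmult_1_l Cmult_plus_distr_r C_one_neq0.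

Fact C_mulVf (z : C) : z != 0 -> Cinv z * z = 1.
Proof. by move=> /eqP nz; exact: Cinv_l. Qed.

Fact C_inv0 : Cinv (0 : C) = 0.
Proof. by rewrite /Cinv /= /Rdiv Rmult_0_l Ropp_0 Rmult_0_l. Qed.

HB.instance Definition _ := GRing.ComNzRing_isField.Build C C_mulVf C_inv0.

Inductive letter := lx | ly.

Definition letter_to_bool (l : letter) : bool := if l is lx then true else false.
Definition bool_to_letter (b : bool) : letter := if b then lx else ly.
Fact letter_to_boolK : cancel letter_to_bool bool_to_letter.
Proof. by case. Qed.

HB.instance Definition _ := Countable.copy letter (can_type letter_to_boolK).

Notation word := (seq letter).

(* C<x,y>, the algebra of the free monoid on {x,y}; its ring product is
   concatenation. *)
Notation ncpoly := {malg C[{fmonom letter}]}.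

Definition mon (w : word) : ncpoly := << FMonom w >>.

Definition lin_ext (V : lmodType C) (f : word -> V) (a : ncpoly) : V :=
  \sum_(w <- msupp a) a@_w *: f w.

Fixpoint shuffle_word (u : word) : word -> ncpoly :=
  fix shuffle_u (v : word) : ncpoly :=
    match u, v with
    | [::], _ => mon v
    | _, [::] => mon u
    | l1 :: u', l2 :: v' =>
        mon [:: l1] * shuffle_word u' v + mon [:: l2] * shuffle_u v'
    end.

Definition shuffle (a b : ncpoly) : ncpoly :=
  lin_ext (fun u => lin_ext (shuffle_word u) b) a.

Definition shuffle_exp (a : ncpoly) (n : nat) : ncpoly := iter n (shuffle a) 1.

Definition in_h0 (a : ncpoly) : Prop :=
  exists (c : C) (b : ncpoly), a = c *: 1 + mon [:: lx] * b * mon [:: ly].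

Definition swap_letter (l : letter) : letter := if l is lx then ly else lx.

Definition tau : ncpoly -> ncpoly :=
  lin_ext (fun w => mon (rev [seq swap_letter l | l <- w])).

(* c is the constant term of a written as a shuffle polynomial in x and y
   with coefficients p i j in h^0. *)
Definition is_reg (a c : ncpoly) : Prop :=
  exists (n : nat) (p : nat -> nat -> ncpoly),
    [/\ forall i j, in_h0 (p i j),
        a = \sum_(i < n.+1) \sum_(j < n.+1)
              shuffle (p i j) (shuffle (shuffle_exp (mon [:: lx]) i)
                                       (shuffle_exp (mon [:: ly]) j))
      & c = p 0%N 0%N].

(* The shuffle decomposition C<x,y> = h^0[x,y] exists and is unique, so this is the only c
   with is_reg a c. *)
Definition reg (a : ncpoly) : ncpoly := epsilon (inhabits 0) (is_reg a).

(* x^(k_1 - 1) y ... x^(k_m - 1) y, for positive k_i. *)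
Definition word_of_index (ks : seq nat) : word :=
  flatten [seq rcons (nseq k.-1 lx) ly | k <- ks].

(* Inverse of word_of_index on the words of h^1; the trailing x's of other
   words are dropped. *)
Fixpoint index_of_word (w : word) : seq nat :=
  match w with
  | [::] => [::]
  | ly :: w' => 1%N :: index_of_word w'
  | lx :: w' => if index_of_word w' is k :: ks then k.+1 :: ks else [::]
  end.

Lemma word_of_indexK (ks : seq nat) :
  all (fun k => (0 < k)%N) ks -> index_of_word (word_of_index ks) = ks.
Proof.
elim: ks => [//|k ks IH] /= /andP[k0 /IH{}IH].
case: k k0 => [//|k] _; rewrite /word_of_index /= -/(word_of_index ks) cat_rcons.
by elim: k => [|k IHk] /=; rewrite ?IH ?IHk.
Qed.

(* The sum over N > n_1 > ... > n_m > 0 of 1/(n_1^k_1 ... n_m^k_m). *)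
Fixpoint harmonic (ks : seq nat) : nat -> R :=
  if ks is k :: ks' then
    fun N => \sum_(1 <= n < N) n%:R ^- k * harmonic ks' n
  else fun _ => 1.

Definition mzv (ks : seq nat) : R :=
  if ks is k :: ks' then
    Series (fun n => n.+1%:R ^- k * harmonic ks' n.+1)
  else 1.

(* Defined on all of C<x,y>, but only meaningful on h^0. *)
Definition zeta_hat (a : ncpoly) : C :=
  lin_ext (fun w => RtoC (mzv (index_of_word w)) : C^o) a.

Definition CSeries (u : nat -> C) : C :=
  (Series (fun n => Complex.Re (u n)), Series (fun n => Complex.Im (u n))).

Definition polylog_series (ks : seq nat) (z : C) : C :=
  if ks is k :: ks' then
    CSeries (fun n =>
      z ^+ n.+1 * n.+1%:R ^- k * RtoC (harmonic ks' n.+1))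
  else 1.

(* The integral of f along the straight segment from 0 to z. *)
Definition segment_int (f : C -> C) (z : C) : C :=
  RInt (V := C_R_CompleteNormedModule)
    (fun t : R => (f (RtoC t * z)%R * z)%R) 0 1.

(* The forms ds/s and ds/(1 - s) attached to x and y. *)
Definition omega (l : letter) (s : C) : C :=
  if l is lx then s^-1 else (1 - s)^-1.

(* Meaningful for words of h^1, where the integrands extend continuously to
   s = 0 and the value of the integral does not depend on the one there. *)
Fixpoint iterated_int (w : word) : C -> C :=
  if w is l :: w' then
    segment_int (fun s => omega l s * iterated_int w' s)
  else fun _ => 1.

(* The slit plane C \ ((-oo,0] U [1,+oo)); it is star-shaped with respect to
   0, in the sense that it contains the segments ]0,z]. *)
Definition slit_plane (z : C) : Prop :=
  ~ (Complex.Im z = 0 /\ (Complex.Re z <= 0 \/ 1 <= Complex.Re z)).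

(* Li(w;z) for w = word_of_index ks: the series in the unit disc, continued to
   the rest of the slit plane by iterated integrals from 0. *)
Definition Li_h1 (ks : seq nat) (z : C) : C :=
  if Cmod z < 1 then polylog_series ks z
  else iterated_int (word_of_index ks) z.

(* Principal argument, in ]-pi, pi] for z != 0. *)
Definition Carg (z : C) : R :=
  if 0 <= Complex.Im z then acos (Complex.Re z / Cmod z) else - acos (Complex.Re z / Cmod z).

Definition Clog (z : C) : C := (ln (Cmod z), Carg z).

Definition is_Li (z : C) (L : ncpoly -> C) : Prop :=
  [/\ forall (c : C) (a b : ncpoly), L (c *: a + b) = c * L a + L b,
      forall a b, L (shuffle a b) = L a * L b,
      L (mon [:: lx]) = Clog z
    & forall ks, all (fun k => (0 < k)%N) ks ->
        L (mon (word_of_index ks)) = Li_h1 ks z].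

(* For z in the slit plane there is exactly one L with is_Li z L, since
   C<x,y> = h^1[x] for the shuffle product. *)
Definition Li (a : ncpoly) (z : C) : C :=
  epsilon (inhabits (fun _ => 0)) (is_Li z) a.

(* Main.v *)
Require Import Defs.
From HB Require Import structures.
From Stdlib Require Import Reals Lra Epsilon.
From Coquelicot Require Import Coquelicot.
From mathcomp Require Import all_boot all_algebra.
From mathcomp Require Import Rstruct finmap.
From mathcomp.multinomials Require Import monalg.
Local Open Scope ring_scope.
Import GRing.Theory.

(* Lam(w; z) is the iterated integral of w for w in h^1, extended to all words
   by (u y x^(n+1)) = (1/(n+1)) ((u y x^n) sh x - (u sh x) y x^n).  It
   solves d Lam(l w) = omega_l Lam(w) on the slit plane D, which is star-shaped
   about 1/2.  Together with the behaviour O(t log^N t) as t -> 0+, these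
   equations force Lam to be a shuffle character, hence to be Li.

   Since 1 - z exchanges omega_x and omega_y, the derivative of
   phi(w) = sum_(w = w1 w2) Lam(tau w1; 1 - z) Lam(w2; z) telescopes to 0, so
   phi(w) is constant on D.  Deconcatenation and tau are shuffle morphisms, so
   phi is a shuffle character; it kills x and y (limits at 0 and 1), hence only
   depends on the constant term reg(w) in h^0[x, y].  On a word x v y of h^0 all
   terms but Lam(x v y; z) tend to 0 as z -> 1-, and Lam(x v y; z) tends to
   zeta(x v y) by positivity of the coefficients. *)

Set Implicit Arguments.
Unset Strict Implicit.

(** * Shuffles of words *)

(** The main obstacle is the base point. Iterated integrals start at 0, a boundary point of D where
    omega_x is singular, so they are not differentiated under the integral sign directly. Each
    integrand first gets a primitive by integration from 1/2, normalised there by the power series;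
    the integral from 0 is then identified with this primitive by a comparison near 0. Growth is
    measured for real t in ]0, 1/2] by two classes, O(log^N t) and O(t log^N t). A product of one of
    each lies in the second, and a constant in the second is 0. Near 1 no expansion of Lam is
    computed: that Lam(w; 1 - t) is O(log^N t) is read off from the constancy of phi, by induction
    on the length of w, because phi expresses it through words taken at t and shorter words taken at
    1 - t. [Li] and [reg] are values of [epsilon]. The explicit Lam shows that a character as in
    [is_Li] exists, and the generation of C<x,y> by h^1 and x that its values on words are forced.
    For [reg], a decomposition is shown to exist, and phi is evaluated on whichever one is
    selected. *)

Fixpoint shl (u : word) : word -> seq word :=
  fix shl_u (v : word) : seq word :=
    match u, v with
    | [::], _ => [:: v]
    | _, [::] => [:: u]
    | a :: u', b :: v' =>
        [seq a :: w | w <- shl u' v] ++ [seq b :: w | w <- shl_u v']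
    end.

Section ShuffleSums.
Variable V : nmodType.
Implicit Types (f : word -> V) (u v w : word).

Lemma shl0l v : shl [::] v = [:: v]. Proof. by case: v. Qed.
Lemma shl0r u : shl u [::] = [:: u]. Proof. by case: u. Qed.

(** Shuffles are kept as lists with multiplicities and tested against an arbitrary [f], so that one
    combinatorial identity serves for [f] equal to [mon], [Lam] or [phi]. *)
Lemma sum_shl_cons f a u b v :
  \sum_(w <- shl (a :: u) (b :: v)) f w =
  \sum_(w <- shl u (b :: v)) f (a :: w) + \sum_(w <- shl (a :: u) v) f (b :: w).
Proof. by rewrite /= big_cat !big_map. Qed.

Arguments shl : simpl never.

Lemma sum_shlC f u v : \sum_(w <- shl u v) f w = \sum_(w <- shl v u) f w.
Proof.
elim: u v f => [|a u IHu] v f; first by rewrite shl0l shl0r.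
elim: v f => [|b v IHv] f; first by rewrite shl0l shl0r.
by rewrite !sum_shl_cons IHu IHv addrC.
Qed.

(** Both sides split by the first letter of the triple shuffle, which comes from [u], [v] or [w];
    each of the three cases is one of the nested induction hypotheses. *)
Lemma sum_shlA f u v w :
  \sum_(s <- shl u v) \sum_(t <- shl s w) f t =
  \sum_(s <- shl v w) \sum_(t <- shl u s) f t.
Proof.
elim: u v w f => [|a u IHu] v w f.
  by rewrite shl0l big_seq1; apply: eq_bigr => s _; rewrite shl0l big_seq1.
elim: v w f => [|b v IHv] w f; first by rewrite shl0r shl0l !big_seq1.
elim: w f => [|c w IHw] f.
  by rewrite shl0r big_seq1; apply: eq_bigr => s _; rewrite shl0r big_seq1.
rewrite !sum_shl_cons.
under eq_bigr do rewrite sum_shl_cons.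
under [X in _ + X = _]eq_bigr do rewrite sum_shl_cons.
under [X in _ = X + _]eq_bigr do rewrite sum_shl_cons.
under [X in _ = _ + X]eq_bigr do rewrite sum_shl_cons.
rewrite !big_split /= IHu IHv addrACA.
(* The words starting with [c] are spread over two sums, according to the first letter of [s]; the
   induction hypothesis on [w] applies to their union. *)
have := IHw (fun t => f (c :: t)); rewrite sum_shl_cons => ->.
rewrite (sum_shl_cons (fun s => \sum_(t <- shl u s) f (a :: t))).
by rewrite -addrA addrACA.
Qed.

(** The shuffle recursion may equally be run from the last letters, which is why the reversal in tau
    respects shuffles. *)
Lemma sum_shl_rcons f u a v b :
  \sum_(w <- shl (rcons u a) (rcons v b)) f w =
  \sum_(w <- shl u (rcons v b)) f (rcons w a) +
  \sum_(w <- shl (rcons u a) v) f (rcons w b).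
Proof.
elim: u v f => [|d u IHu] v f; elim: v f => [|c v IHv] f /=.
- by rewrite sum_shl_cons !shl0l !shl0r !big_seq1 addrC.
- by rewrite !sum_shl_cons IHv !shl0l !big_seq1 addrCA.
- rewrite !sum_shl_cons (IHu [::]) /= !shl0r !big_seq1 /= -addrA [X in _ + X]addrC.
  by rewrite addrA.
- rewrite !sum_shl_cons -rcons_cons IHu -[d :: rcons u a]rcons_cons IHv.
  by rewrite !rcons_cons addrACA.
Qed.

Definition tau_word (w : word) : word := rev [seq swap_letter l | l <- w].

Lemma tau_word_cons a w : tau_word (a :: w) = rcons (tau_word w) (swap_letter a).
Proof. by rewrite /tau_word /= rev_cons. Qed.

Lemma tau_word_rcons w a : tau_word (rcons w a) = swap_letter a :: tau_word w.
Proof. by rewrite /tau_word map_rcons rev_rcons. Qed.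

Lemma sum_shl_tau f u v :
  \sum_(w <- shl u v) f (tau_word w) = \sum_(w <- shl (tau_word u) (tau_word v)) f w.
Proof.
elim: u v f => [|a u IHu] v f; first by rewrite !shl0l !big_seq1.
elim: v f => [|b v IHv] f; first by rewrite !shl0r !big_seq1.
rewrite sum_shl_cons !tau_word_cons sum_shl_rcons -!tau_word_cons -IHu -IHv.
by congr (_ + _); apply: eq_bigr => w _; rewrite tau_word_cons.
Qed.

(** The recursive form of the sum over factorizations, which the theorem indexes by ordinals. It
    supports induction on the word, with [f] changing as letters pass to the prefix. *)
Fixpoint dsum (f : word -> word -> V) (w : word) : V :=
  f [::] w + (if w is a :: w' then dsum (fun p s => f (a :: p) s) w' else 0).

Lemma dsumE (f : word -> word -> V) w : \sum_(i < (size w).+1) f (take i w) (drop i w) = dsum f w.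
Proof.
elim: w f => [|a w IH] f; first by rewrite big_ord_recl big_ord0.
rewrite big_ord_recl take0 drop0 [in RHS]/= -IH.
by congr (_ + _); apply: eq_bigr => i _.
Qed.

Lemma eq_dsum (f g : word -> word -> V) w : (forall p s, f p s = g p s) -> dsum f w = dsum g w.
Proof.
elim: w f g => [|a w IH] f g fg /=; rewrite fg //.
by congr (_ + _); apply: IH => p s; rewrite fg.
Qed.

Lemma dsumD (f g : word -> word -> V) w : dsum (fun p s => f p s + g p s) w = dsum f w + dsum g w.
Proof.
elim: w f g => [|a w IH] f g /=; first by rewrite !addr0.
by rewrite IH addrACA.
Qed.

(* Deconcatenation is a morphism for the shuffle product. *)
Lemma sum_shl_dsum (f : word -> word -> V) u v :
  \sum_(w <- shl u v) dsum f w =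
  dsum (fun u1 u2 => dsum (fun v1 v2 =>
    \sum_(w1 <- shl u1 v1) \sum_(w2 <- shl u2 v2) f w1 w2) v) u.
Proof.
elim: u v f => [|a u IHu] v f.
  rewrite shl0l big_seq1 /= addr0; apply: eq_dsum => p s.
  by rewrite !shl0l !big_seq1.
elim: v f => [|b v IHv] f.
  rewrite shl0r big_seq1 -[LHS]/(dsum f (a :: u)); apply: eq_dsum => p s /=.
  by rewrite addr0 !shl0r !big_seq1.
(* A nonempty prefix of a shuffle starts with [a] or with [b], and each induction hypothesis covers
   one case. The terms are then regrouped according to which of the prefixes of [a :: u] and
   [b :: v] are empty. *)
rewrite sum_shl_cons /= !big_split /= IHu IHv /= addrACA.
rewrite shl0l big_seq1 sum_shl_cons -!addrA; congr (_ + (_ + _)).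
rewrite addrCA -dsumD; congr (_ + _).
  by apply: eq_dsum => p s; rewrite !shl0l !big_seq1.
apply: eq_dsum => p s; rewrite !shl0r !big_seq1 -addrA -dsumD.
congr (_ + _); apply: eq_dsum => p' s'.
by rewrite sum_shl_cons.
Qed.

End ShuffleSums.

(** * Shuffling a word with a single letter *)

Section Insertion.
Variable V : nmodType.
Implicit Types (f : word -> V) (u v w : word) (a b : letter).

Lemma sum_shl_nseq f a n :
  \sum_(w <- shl (nseq n a) [:: a]) f w = f (nseq n.+1 a) *+ n.+1.
Proof.
elim: n f => [|n IH] f; first by rewrite shl0l big_seq1.
by rewrite sum_shl_cons IH shl0r big_seq1 -mulrSr.
Qed.

(** The new letter lands either before [b] or in one of the n + 1 slots of the final block, all of
    which give the same word. *)
Lemma sum_shl_insert_suffix f u b n a :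
  \sum_(w <- shl (u ++ b :: nseq n a) [:: a]) f w =
  \sum_(v <- shl u [:: a]) f (v ++ b :: nseq n a)
  + f (u ++ b :: nseq n.+1 a) *+ n.+1.
Proof.
elim: u f => [|c u IH] f.
  by rewrite sum_shl_cons sum_shl_nseq shl0l shl0r !big_seq1 addrC.
by rewrite !sum_shl_cons IH !shl0r !big_seq1 addrAC.
Qed.

Lemma sum_shl_insert_prefix f k a b v :
  \sum_(w <- shl (nseq k a ++ b :: v) [:: a]) f w =
  f (nseq k.+1 a ++ b :: v) *+ k.+1
  + \sum_(w <- shl v [:: a]) f (nseq k a ++ b :: w).
Proof.
elim: k f => [|k IH] f; first by rewrite sum_shl_cons shl0r big_seq1 addrC.
by rewrite sum_shl_cons IH shl0r big_seq1 addrAC -mulrSr.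
Qed.

End Insertion.

(** * The shuffle algebra *)

Lemma word_casesr (w : word) :
  w = nseq (size w) lx \/ exists u n, w = u ++ ly :: nseq n lx.
Proof.
elim: w => [|a w [E|[u [n E]]]]; first by left.
- case: a; first by left; rewrite /= -E.
  by right; exists [::], (size w); rewrite /= -E.
- by right; exists (a :: u), n; rewrite E.
Qed.

Lemma word_casesl (w : word) :
  w = nseq (size w) ly \/ exists k v, w = nseq k ly ++ lx :: v.
Proof.
elim: w => [|a w IH]; first by left.
case: a; first by right; exists 0%N, w.
case: IH => [E|[k [v E]]]; first by left; rewrite /= -E.
by right; exists k.+1, v; rewrite /= -E.
Qed.

Lemma natrC (n : nat) : n%:R = RtoC (INR n) :> C.
Proof.
by elim: n => [|n IH] //; rewrite mulrSr IH S_INR RtoC_plus.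
Qed.

Lemma C_natr_neq0 n : n.+1%:R != 0 :> C.
Proof.
rewrite natrC; apply/eqP => /(congr1 fst) /=.
by move=> E0; apply: (not_0_INR n.+1) => [|].
Qed.

Section LinearExtension.
Variable V : lmodType C.
Implicit Type f : word -> V.

Lemma lin_extEw (d : {fset {fmonom letter}}) f (a : ncpoly) :
  (msupp a `<=` d)%fset -> lin_ext f a = \sum_(w <- d) a@_w *: f w.
Proof.
move=> sd; rewrite /lin_ext (big_fset_incl _ sd) //.
by move=> w _ /mcoeff_outdom ->; rewrite scale0r.
Qed.

Lemma lin_ext_mon f w : lin_ext f (mon w) = f w.
Proof. by rewrite /lin_ext msuppU oner_eq0 big_seq_fset1 mcoeffUU scale1r. Qed.

Lemma lin_extP f (c : C) (a b : ncpoly) :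
  lin_ext f (c *: a + b) = c *: lin_ext f a + lin_ext f b.
Proof.
pose d := (msupp a `|` msupp b `|` msupp (c *: a + b))%fset.
have da : (msupp a `<=` d)%fset by exact: fsubset_trans (fsubsetUl _ _) (fsubsetUl _ _).
have db : (msupp b `<=` d)%fset by exact: fsubset_trans (fsubsetUr _ _) (fsubsetUl _ _).
have dc : (msupp (c *: a + b) `<=` d)%fset by exact: fsubsetUr.
rewrite (lin_extEw f da) (lin_extEw f db) (lin_extEw f dc).
rewrite scaler_sumr -big_split; apply: eq_bigr => w _.
by rewrite mcoeffD mcoeffZ scalerDl scalerA.
Qed.

Lemma lin_ext0 f : lin_ext f 0 = 0.
Proof. by rewrite /lin_ext msupp0 big_seq_fset0. Qed.

Lemma lin_extD f (a b : ncpoly) : lin_ext f (a + b) = lin_ext f a + lin_ext f b.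
Proof. by have := lin_extP f 1 a b; rewrite !scale1r. Qed.

Lemma lin_extZ f (c : C) (a : ncpoly) : lin_ext f (c *: a) = c *: lin_ext f a.
Proof. by have := lin_extP f c a 0; rewrite lin_ext0 !addr0. Qed.

Lemma lin_ext_sum f I (r : seq I) (F : I -> ncpoly) :
  lin_ext f (\sum_(i <- r) F i) = \sum_(i <- r) lin_ext f (F i).
Proof. exact: (big_morph (lin_ext f) (lin_extD f) (lin_ext0 f)). Qed.

End LinearExtension.

Lemma ncpoly_ind (Q : ncpoly -> Prop) :
  Q 0 -> (forall c w a, Q a -> Q (c *: mon w + a)) -> forall a, Q a.
Proof.
move=> Q0 QS a; rewrite (monalgE a).
elim: (enum_fset (msupp a)) => [|w s IH]; first by rewrite big_nil.
rewrite big_cons; have := QS a@_w w _ IH; congr (Q (_ + _)).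
by case: w {IH} => w; apply/malgP => k; rewrite mcoeffZ !mcoeffU mulr_natr.
Qed.

Lemma mon_cat u v : mon u * mon v = mon (u ++ v).
Proof.
rewrite malgME !msuppU oner_eq0 !big_seq_fset1 !mcoeffUU mulr1 /mon.
by congr mkmalgU; apply: val_inj; rewrite /= fmM.
Qed.

Lemma shuffle_wordE u v : shuffle_word u v = \sum_(w <- shl u v) mon w.
Proof.
elim: u v => [|a u IHu] v; first by case: v => [|b v]; rewrite shl0l big_seq1.
elim: v => [|b v IHv]; first by rewrite shl0r big_seq1.
rewrite sum_shl_cons /= -/(shuffle_word (a :: u) v) IHu IHv !mulr_sumr.
by congr (_ + _); apply: eq_bigr => w _; rewrite mon_cat.
Qed.

Lemma shuffleZl (c : C) a b : shuffle (c *: a) b = c *: shuffle a b.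
Proof. exact: lin_extZ. Qed.

Lemma shuffle_monl u a : shuffle (mon u) a = lin_ext (shuffle_word u) a.
Proof. exact: lin_ext_mon. Qed.

Lemma shuffle0l a : shuffle 0 a = 0. Proof. exact: lin_ext0. Qed.

Lemma shuffle_linl (c : C) a b d :
  shuffle (c *: a + b) d = c *: shuffle a d + shuffle b d.
Proof. exact: lin_extP. Qed.

Lemma shuffle_mon u v : shuffle (mon u) (mon v) = \sum_(w <- shl u v) mon w.
Proof. by rewrite shuffle_monl lin_ext_mon shuffle_wordE. Qed.

Lemma shuffle_linr (c : C) a b d :
  shuffle d (c *: a + b) = c *: shuffle d a + shuffle d b.
Proof.
elim/ncpoly_ind: d => [|k w d IH]; first by rewrite !shuffle0l scaler0 addr0.
rewrite !shuffle_linl IH !shuffle_monl lin_extP.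
have swap (V : lmodType C) (A B D E : V) :
    k *: (c *: A + B) + (c *: D + E) = c *: (k *: A + D) + (k *: B + E).
  by rewrite !scalerDr !scalerA mulrC addrACA.
exact: swap.
Qed.

Lemma shuffle0r a : shuffle a 0 = 0.
Proof.
by have := shuffle_linr (-1) 0 0 a; rewrite scaler0 addr0 scaleN1r addNr.
Qed.

Lemma shuffleDl a b d : shuffle (a + b) d = shuffle a d + shuffle b d.
Proof. by have := shuffle_linl 1 a b d; rewrite !scale1r. Qed.

Lemma shuffleDr a b d : shuffle d (a + b) = shuffle d a + shuffle d b.
Proof. by have := shuffle_linr 1 a b d; rewrite !scale1r. Qed.

Lemma shuffle_suml I (r : seq I) (F : I -> ncpoly) a :
  shuffle (\sum_(i <- r) F i) a = \sum_(i <- r) shuffle (F i) a.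
Proof. exact: (big_morph (shuffle^~ a) (fun x y => shuffleDl x y a) (shuffle0l a)). Qed.

Lemma shuffle_sumr I (r : seq I) (F : I -> ncpoly) a :
  shuffle a (\sum_(i <- r) F i) = \sum_(i <- r) shuffle a (F i).
Proof. exact: (big_morph (shuffle a) (fun x y => shuffleDr x y a) (shuffle0r a)). Qed.

Lemma shuffleC a b : shuffle a b = shuffle b a.
Proof.
elim/ncpoly_ind: a => [|c u a IH]; first by rewrite shuffle0l shuffle0r.
rewrite (shuffle_linl c (mon u) a b) (shuffle_linr c (mon u) a b) IH.
suff -> : shuffle (mon u) b = shuffle b (mon u) by [].
elim/ncpoly_ind: b {IH} => [|d v b IH]; first by rewrite shuffle0l shuffle0r.
rewrite (shuffle_linr d (mon v) b) (shuffle_linl d (mon v) b) IH.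
by rewrite !shuffle_mon sum_shlC.
Qed.

Lemma lin_map_ext (V : lmodType C) (f g : ncpoly -> V) :
  (forall c a b, f (c *: a + b) = c *: f a + f b) ->
  (forall c a b, g (c *: a + b) = c *: g a + g b) ->
  (forall w, f (mon w) = g (mon w)) -> forall a, f a = g a.
Proof.
move=> fL gL fg.
have z (h : ncpoly -> V) : (forall c a b, h (c *: a + b) = c *: h a + h b) -> h 0 = 0.
  by move=> hL; have := hL (-1) 0 0; rewrite scaler0 addr0 scaleN1r addNr.
elim/ncpoly_ind => [|c w a IH]; first by rewrite (z _ fL) (z _ gL).
by rewrite fL gL fg IH.
Qed.

Lemma shuffleA a b d : shuffle (shuffle a b) d = shuffle a (shuffle b d).
Proof.
move: a; refine (@lin_map_ext _ (fun a => shuffle (shuffle a b) d)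
                              (fun a => shuffle a (shuffle b d)) _ _ _); last move=> u.
- by move=> c a1 a2; rewrite (shuffle_linl c a1) (shuffle_linl c (shuffle a1 b)).
- by move=> c a1 a2; exact: shuffle_linl.
move: b; refine (@lin_map_ext _ (fun b => shuffle (shuffle (mon u) b) d)
                              (fun b => shuffle (mon u) (shuffle b d)) _ _ _); last move=> v.
- by move=> c b1 b2; rewrite (shuffle_linr c b1) (shuffle_linl c (shuffle _ b1)).
- by move=> c b1 b2; rewrite (shuffle_linl c b1) (shuffle_linr c (shuffle b1 d)).
move: d; refine (@lin_map_ext _ (shuffle (shuffle (mon u) (mon v)))
                              (fun d => shuffle (mon u) (shuffle (mon v) d)) _ _ _); last move=> w.
- by move=> c d1 d2; exact: shuffle_linr.
- by move=> c d1 d2; rewrite (shuffle_linr c d1) (shuffle_linr c (shuffle _ d1)).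
rewrite (shuffle_mon u v) (shuffle_mon v w) shuffle_suml shuffle_sumr.
under eq_bigr do rewrite shuffle_mon.
under [in RHS]eq_bigr do rewrite shuffle_mon.
by rewrite sum_shlA.
Qed.

Lemma mon_nil : mon [::] = 1.
Proof. by rewrite /mon; congr mkmalgU; apply: val_inj; rewrite /= fm1. Qed.

Lemma shuffle1l a : shuffle 1 a = a.
Proof.
rewrite -mon_nil; elim/ncpoly_ind: a => [|c w a IH]; first exact: shuffle0r.
by rewrite shuffle_linr IH shuffle_mon shl0l big_seq1.
Qed.

(** Bilinearity reduces the character property to words, where it is [Lam_shl] or [phi_shl]. *)
Lemma lin_ext_shuffle (f : word -> C) :
  (forall u v, \sum_(w <- shl u v) f w = f u * f v) ->
  forall a b, lin_ext (V := C^o) f (shuffle a b)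
              = lin_ext (V := C^o) f a * lin_ext (V := C^o) f b.
Proof.
move=> fM a b; set L := lin_ext _.
have L_lin (c : C) a' b' : L (c *: a' + b') = c * L a' + L b' by exact: lin_extP.
move: a; refine (@lin_map_ext C^o (fun a => L (shuffle a b)) (fun a => L a * L b) _ _ _);
  last move=> u.
- by move=> c a1 a2; rewrite (shuffle_linl c a1) L_lin.
- by move=> c a1 a2; rewrite L_lin mulrDl -mulrA.
move: b; refine (@lin_map_ext C^o (fun b => L (shuffle (mon u) b))
                                 (fun b => L (mon u) * L b) _ _ _); last move=> v.
- by move=> c b1 b2; rewrite (shuffle_linr c b1) L_lin.
- by move=> c b1 b2; rewrite L_lin mulrDr mulrCA.
rewrite shuffle_mon /L lin_ext_sum !lin_ext_mon -fM.
by apply: eq_bigr => w _; rewrite lin_ext_mon.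
Qed.

Section Generation.
Variable Q : ncpoly -> Prop.
Hypothesis Q0 : Q 0.
Hypothesis Q_lin : forall c a b, Q a -> Q b -> Q (c *: a + b).

Let Q_sum (I : Type) (r : seq I) (F : I -> ncpoly) :
  (forall i, Q (F i)) -> Q (\sum_(i <- r) F i).
Proof.
move=> QF; elim: r => [|i r IH]; first by rewrite big_nil.
by rewrite big_cons -[F i]scale1r; apply: Q_lin.
Qed.

(** Here characteristic 0 enters: an insertion relation is solved for its term of multiplicity n +
    1. *)
Let Q_solve n a b d : a = b + d *+ n.+1 -> Q a -> Q b -> Q d.
Proof.
move=> E Qa Qb.
have -> : d = n.+1%:R^-1 *: ((-1) *: b + a) + 0.
  rewrite E scaleN1r addKr addr0 -scaler_nat scalerA mulVf ?scale1r //.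
  exact: C_natr_neq0.
by apply/Q_lin/Q0/Q_lin.
Qed.

(** The generation half of h = h^1[x]: the insertion relation removes the trailing x's of a word one
    at a time. *)
Lemma h1_word_ind :
  (forall a, Q a -> Q (shuffle a (mon [:: lx]))) ->
  Q (mon [::]) -> (forall u, Q (mon (rcons u ly))) -> forall w, Q (mon w).
Proof.
move=> Qx Q1 Qy w; have [->|[u [n ->]]] := word_casesr w.
  elim: (size w) => [//|n IH]; apply: (@Q_solve n _ _ _ _ (Qx _ IH) Q0).
  by rewrite shuffle_mon sum_shl_nseq add0r.
elim: n u => [|n IH] u; first by rewrite cats1.
apply: (@Q_solve n _ _ _ _ (Qx _ (IH u))).
  by rewrite shuffle_mon sum_shl_insert_suffix.
by apply: Q_sum => v.
Qed.

(** The generation half of h^1 = h^0[y]: now the leading y's are removed, while the final y has to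
    be preserved. *)
Lemma h0_word_ind :
  (forall a, Q a -> Q (shuffle a (mon [:: ly]))) ->
  Q (mon [::]) -> (forall u, Q (mon (lx :: rcons u ly))) ->
  forall u, Q (mon (rcons u ly)).
Proof.
move=> Qy Q1 Qxy u.
have Qk k v : Q (mon (nseq k ly ++ lx :: rcons v ly)).
  elim: k v => [|k IH] v; first exact: Qxy.
  apply: (@Q_solve k _ _ _ _ (Qy _ (IH v))).
    by rewrite shuffle_mon sum_shl_insert_prefix addrC.
  (* Splitting by the last letter shows that every word of the sum still ends in y, so that the
     induction hypothesis applies to it. *)
  rewrite -[[:: ly]]/(rcons [::] ly) sum_shl_rcons shl0r big_seq1 addrC.
  rewrite -[mon _]scale1r; apply: Q_lin; first exact: IH.
  by apply: Q_sum => s; apply: IH.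
have [->|[k [v E]]] := word_casesl (rcons u ly).
  elim: (size _) => [//|n IH]; apply: (@Q_solve n _ _ _ _ (Qy _ IH) Q0).
  by rewrite shuffle_mon sum_shl_nseq add0r.
(* What follows the first x is nonempty and ends in y, because the whole word ends in y. *)
rewrite E; case/lastP: v E => [|v a] E.
  by have := congr1 (last lx) E; rewrite last_rcons last_cat.
suff <- : ly = a by [].
by have := congr1 (last lx) E; rewrite last_rcons last_cat /= last_rcons.
Qed.

End Generation.

(** * Primitives on the slit plane *)

Section ComplexCalculus.
Local Open Scope R_scope.

Lemma is_derive_eq (f : R -> R) (t l m : R) :
  is_derive f t l -> l = m -> is_derive f t m.
Proof. by move=> H <-. Qed.

Lemma is_derive_Rplus (f g : R -> R) (t l m : R) :
  is_derive f t l -> is_derive g t m -> is_derive (fun s => f s + g s) t (l + m).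
Proof. exact: is_derive_plus. Qed.

Lemma is_derive_Rminus (f g : R -> R) (t l m : R) :
  is_derive f t l -> is_derive g t m -> is_derive (fun s => f s - g s) t (l - m).
Proof. exact: is_derive_minus. Qed.

Lemma is_derive_Ropp (f : R -> R) (t l : R) :
  is_derive f t l -> is_derive (fun s => - f s) t (- l).
Proof. exact: is_derive_opp. Qed.

Lemma is_derive_Rmult (f g : R -> R) (t l m : R) :
  is_derive f t l -> is_derive g t m ->
  is_derive (fun s => f s * g s) t (l * g t + f t * m).
Proof. by move=> Hf Hg; apply: is_derive_mult => // *; apply: Rmult_comm. Qed.

Lemma is_derive_Rcomp (f g : R -> R) (t l m : R) :
  is_derive f (g t) l -> is_derive g t m -> is_derive (fun s => f (g s)) t (m * l).
Proof. exact: is_derive_comp. Qed.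

Definition cderiv (f : R -> C) (t : R) (l : C) : Prop :=
  is_derive (fun s => fst (f s)) t (fst l) /\
  is_derive (fun s => snd (f s)) t (snd l).

Lemma cderiv_eq (f : R -> C) (t : R) (l m : C) :
  cderiv f t l -> l = m -> cderiv f t m.
Proof. by move=> H <-. Qed.

Lemma cderiv_ext_loc (f g : R -> C) (t : R) (l : C) :
  locally t (fun s => f s = g s) -> cderiv f t l -> cderiv g t l.
Proof.
by move=> fg [f1 f2]; split; [apply: is_derive_ext_loc f1|apply: is_derive_ext_loc f2];
  apply: filter_imp fg => s ->.
Qed.

Lemma cderiv_ext (f g : R -> C) (t : R) (l : C) :
  (forall s, f s = g s) -> cderiv f t l -> cderiv g t l.
Proof. by move=> fg; apply: cderiv_ext_loc; apply: filter_forall. Qed.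

Lemma cderiv_const (c : C) (t : R) : cderiv (fun=> c) t (RtoC 0).
Proof. by split; apply: is_derive_const. Qed.

Lemma cderiv_plus (f g : R -> C) (t : R) (l m : C) :
  cderiv f t l -> cderiv g t m -> cderiv (fun s => (f s + g s)%C) t (l + m)%C.
Proof. by move=> [f1 f2] [g1 g2]; split; apply: is_derive_plus. Qed.

Lemma cderiv_mult (f g : R -> C) (t : R) (l m : C) :
  cderiv f t l -> cderiv g t m ->
  cderiv (fun s => (f s * g s)%C) t (l * g t + f t * m)%C.
Proof.
move=> [f1 f2] [g1 g2]; split => /=.
  apply: is_derive_eq (is_derive_Rminus (is_derive_Rmult f1 g1) (is_derive_Rmult f2 g2)) _.
  by ring.
apply: is_derive_eq (is_derive_Rplus (is_derive_Rmult f1 g2) (is_derive_Rmult f2 g1)) _.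
by ring.
Qed.

Lemma cderiv_scal (c : C) (f : R -> C) (t : R) (l : C) :
  cderiv f t l -> cderiv (fun s => (c * f s)%C) t (c * l)%C.
Proof.
by move=> Hf; apply: cderiv_eq (cderiv_mult (cderiv_const c t) Hf) _; ring.
Qed.

Lemma cderiv_inv (f : R -> C) (t : R) (l : C) :
  f t <> RtoC 0 -> cderiv f t l ->
  cderiv (fun s => (/ f s)%C) t (- l / (f t * f t))%C.
Proof.
move=> fn0 [f1 f2].
set a := fst (f t); set b := snd (f t).
have n0 : a * a + b * b <> 0.
  move=> H; apply: fn0; rewrite [f t]surjective_pairing -/a -/b.
  have -> : a = 0 by nra.
  by have -> : b = 0 by nra.
have D : is_derive (fun s => fst (f s) * fst (f s) + snd (f s) * snd (f s)) t
    (2 * a * fst l + 2 * b * snd l).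
  apply: is_derive_eq (is_derive_Rplus (is_derive_Rmult f1 f1) (is_derive_Rmult f2 f2)) _.
  by rewrite -/a -/b; ring.
have E s : (/ f s)%C = (fst (f s) / (fst (f s) * fst (f s) + snd (f s) * snd (f s)),
                       - snd (f s) / (fst (f s) * fst (f s) + snd (f s) * snd (f s))).
  by rewrite /Cinv /= !Rmult_1_r.
have D1 := is_derive_div _ _ _ _ _ f1 D n0.
have D2 := is_derive_div _ _ _ _ _ (is_derive_Ropp f2) D n0.
have n1 : (a * a - b * b) * (a * a - b * b) + (a * b + b * a) * (a * b + b * a) <> 0.
  have -> : (a * a - b * b) * (a * a - b * b) + (a * b + b * a) * (a * b + b * a)
          = (a * a + b * b) * (a * a + b * b) by ring.
  by apply: Rmult_integral_contrapositive.
split.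
  apply: (is_derive_ext _ _ _ _ (fun s => congr1 fst (esym (E s)))).
  by apply: is_derive_eq D1 _; rewrite /= -/a -/b; field.
apply: (is_derive_ext _ _ _ _ (fun s => congr1 snd (esym (E s)))).
by apply: is_derive_eq D2 _; rewrite /= -/a -/b; field.
Qed.

Lemma cderiv_affine (z h : C) (t : R) : cderiv (fun s => (z + RtoC s * h)%C) t h.
Proof.
have A (x y : R) : is_derive (fun s => x + s * y) t y.
  by auto_derive => //; ring.
by split; [apply: is_derive_ext (A (fst z) (fst h))|
           apply: is_derive_ext (A (snd z) (snd h))] => s /=; ring.
Qed.

Lemma cderiv_comp (f : R -> C) (g : R -> R) (t dg : R) (l : C) :
  is_derive g t dg -> cderiv f (g t) l ->
  cderiv (fun s => f (g s)) t (RtoC dg * l)%C.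
Proof.
move=> Hg [f1 f2]; split.
  by apply: is_derive_eq (is_derive_Rcomp f1 Hg) _ => /=; ring.
by apply: is_derive_eq (is_derive_Rcomp f2 Hg) _ => /=; ring.
Qed.

End ComplexCalculus.

(** * Continuity and integration by components *)

Section ComplexIntegration.
Local Open Scope R_scope.

Definition cts {U : UniformSpace} (f : U -> C) (u : U) : Prop :=
  continuous (fun v => fst (f v)) u /\ continuous (fun v => snd (f v)) u.

Lemma cts_ext_loc (U : UniformSpace) (f g : U -> C) (u : U) :
  locally u (fun v => f v = g v) -> cts f u -> cts g u.
Proof.
by move=> fg [f1 f2]; split; [apply: continuous_ext_loc f1|apply: continuous_ext_loc f2];
  apply: filter_imp fg => s ->.
Qed.

Lemma cts_const (U : UniformSpace) (c : C) (u : U) : cts (fun=> c) u.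
Proof. by split; apply: continuous_const. Qed.

Lemma cts_plus (U : UniformSpace) (f g : U -> C) (u : U) :
  cts f u -> cts g u -> cts (fun v => (f v + g v)%C) u.
Proof. by move=> [f1 f2] [g1 g2]; split; apply: (continuous_plus (V := R_NormedModule)). Qed.

Lemma cts_mult (U : UniformSpace) (f g : U -> C) (u : U) :
  cts f u -> cts g u -> cts (fun v => (f v * g v)%C) u.
Proof.
move=> [f1 f2] [g1 g2]; split.
  by apply: (continuous_minus (V := R_NormedModule));
    apply: (continuous_mult (K := R_AbsRing)).
by apply: (continuous_plus (V := R_NormedModule));
  apply: (continuous_mult (K := R_AbsRing)).
Qed.

Lemma cts_inv (U : UniformSpace) (f : U -> C) (u : U) :
  f u <> RtoC 0 -> cts f u -> cts (fun v => (/ f v)%C) u.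
Proof.
move=> fn0 [f1 f2].
have n0 : fst (f u) ^ 2 + snd (f u) ^ 2 <> 0.
  move=> H; apply: fn0; rewrite [f u]surjective_pairing.
  have -> : fst (f u) = 0 by nra.
  by have -> : snd (f u) = 0 by nra.
have M (g h : U -> R) : continuous g u -> continuous h u ->
    continuous (fun v => g v * h v) u by apply: (continuous_mult (K := R_AbsRing)).
have Q : continuous (fun v => fst (f v) ^ 2 + snd (f v) ^ 2) u.
  apply: (continuous_plus (V := R_NormedModule)); rewrite /=; apply: (M _ _) => //;
  by apply: (M _ _) => //; apply: continuous_const.
have I : continuous (fun v => / (fst (f v) ^ 2 + snd (f v) ^ 2)) u.
  by apply: (continuous_comp (fun v => fst (f v) ^ 2 + snd (f v) ^ 2) Rinv u Q);
    apply: continuous_Rinv.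
split; apply: (M _ _) => //.
exact: (continuous_opp (V := R_NormedModule)).
Qed.

Lemma cts_comp (U : UniformSpace) (f : C -> C) (g : U -> C) (u : U) :
  cts (U := C_UniformSpace) f (g u) -> cts g u -> cts (fun v => f (g v)) u.
Proof.
move=> [f1 f2] [g1 g2].
have G : filterlim g (locally u) (locally (g u : C_UniformSpace)).
  move=> P [e He]; rewrite /filtermap.
  have h1 : locally u (fun v => ball (fst (g u)) e (fst (g v))) := g1 _ (locally_ball _ e).
  have h2 : locally u (fun v => ball (snd (g u)) e (snd (g v))) := g2 _ (locally_ball _ e).
  by refine (filter_imp _ _ _ (filter_and _ _ h1 h2)) => v ?; apply: He.
by split; [exact: (filterlim_comp _ _ _ _ _ _ _ _ G f1)|
           exact: (filterlim_comp _ _ _ _ _ _ _ _ G f2)].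
Qed.

Lemma cderiv_cts (f : R -> C) (t : R) (l : C) : cderiv f t l -> cts f t.
Proof. by move=> [f1 f2]; split; apply: ex_derive_continuous; eexists; eassumption. Qed.

Lemma cts_affine (z h : C) (t : R) : cts (fun s : R => (z + RtoC s * h)%C) t.
Proof. exact: cderiv_cts (cderiv_affine z h t). Qed.

Definition is_CInt (f : R -> C) (a b : R) (l : C) : Prop :=
  is_RInt (fun t => fst (f t)) a b (fst l) /\ is_RInt (fun t => snd (f t)) a b (snd l).

Lemma is_CInt_ext (f g : R -> C) (a b : R) (l : C) :
  a <= b -> (forall t, a < t < b -> f t = g t) -> is_CInt f a b l -> is_CInt g a b l.
Proof.
move=> ab fg [f1 f2]; split; [apply: is_RInt_ext f1|apply: is_RInt_ext f2] => t;
  rewrite Rmin_left // Rmax_right // => /fg -> //.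
Qed.

Lemma is_CInt_Chasles (f : R -> C) (a b c : R) (l m : C) :
  is_CInt f a b l -> is_CInt f b c m -> is_CInt f a c (l + m)%C.
Proof. by move=> [f1 f2] [g1 g2]; split; [apply: is_RInt_Chasles f1 g1|apply: is_RInt_Chasles f2 g2]. Qed.

Lemma is_CInt_derive (F f : R -> C) (a b : R) :
  a <= b ->
  (forall t, a <= t <= b -> cderiv F t (f t)) ->
  (forall t, a <= t <= b -> cts f t) -> is_CInt f a b (F b - F a)%C.
Proof.
move=> ab dF cf; split; apply: (is_RInt_derive (V := R_CompleteNormedModule)
   (fun t => _ (F t)) (fun t => _ (f t))) => t; rewrite Rmin_left // Rmax_right // => tab.
- exact: (dF t tab).1.
- exact: (cf t tab).1.
- exact: (dF t tab).2.
- exact: (cf t tab).2.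
Qed.

Lemma segment_intE (f : C -> C) (z l : C) :
  is_CInt (fun t => (f (RtoC t * z) * z)%C) 0 1 l -> segment_int f z = l.
Proof.
move=> [f1 f2]; rewrite /segment_int.
apply: (is_RInt_unique (V := C_R_CompleteNormedModule)).
rewrite [l]surjective_pairing.
exact: (is_RInt_fct_extend_pair (U := R_NormedModule) (V := R_NormedModule)).
Qed.

Lemma cderiv0_const (F : R -> C) (a b : R) :
  a <= b -> (forall t, a <= t <= b -> cderiv F t (RtoC 0)) -> F a = F b.
Proof.
case=> [ab|-> //] dF; rewrite [F a]surjective_pairing [F b]surjective_pairing.
congr pair.
  by apply: (eq_is_derive (fun t => fst (F t))) ab => t /dF[].
by apply: (eq_is_derive (fun t => snd (F t))) ab => t /dF[].
Qed.

Lemma Cmod_le_abs (z : C) : Cmod z <= Rabs (fst z) + Rabs (snd z).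
Proof.
have p1 := Rabs_pos (fst z); have p2 := Rabs_pos (snd z).
rewrite /Cmod -[X in _ <= X]sqrt_Rsqr; last lra.
apply: sqrt_le_1_alt.
rewrite -(pow2_abs (fst z)) -(pow2_abs (snd z)) /Rsqr /=; nra.
Qed.

Lemma Rabs_fst_le (z : C) : Rabs (fst z) <= Cmod z.
Proof. by apply: Rle_trans (Rmax_Cmod z); apply: Rmax_l. Qed.

Lemma Rabs_snd_le (z : C) : Rabs (snd z) <= Cmod z.
Proof. by apply: Rle_trans (Rmax_Cmod z); apply: Rmax_r. Qed.

(** The real mean value theorem is applied to each component separately, whence the factor 2. *)
Lemma cderiv_increment (F f : R -> C) (M : R) :
  (forall t, 0 <= t <= 1 -> cderiv F t (f t)) ->
  (forall t, 0 <= t <= 1 -> Cmod (f t) <= M) ->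
  Cmod (F 1 - F 0)%C <= 2 * M.
Proof.
move=> dF bf; apply: Rle_trans (Cmod_le_abs _) _.
have mv (g dg : R -> R) : (forall t, 0 <= t <= 1 -> is_derive g t (dg t)) ->
    (forall t, 0 <= t <= 1 -> Rabs (dg t) <= M) -> Rabs (g 1 + - g 0) <= M.
  move=> Hg Hb.
  have [t [ht]] : exists t, 0 <= t <= 1 /\ g 1 - g 0 = dg t * (1 - 0).
    have [||t [ht Et]] := MVT_gen g 0 1 dg.
    - by move=> t; rewrite Rmin_left ?Rmax_right; try lra; move=> ?; apply: Hg; lra.
    - move=> t; rewrite Rmin_left ?Rmax_right; try lra; move=> ht.
      apply: derivable_continuous_pt; exists (dg t).
      by apply/is_derive_Reals/Hg.
    by exists t; move: ht; rewrite Rmin_left ?Rmax_right; try lra.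
  rewrite /Rminus => -> /=; rewrite Ropp_0 Rplus_0_r Rmult_1_r; exact: Hb.
have H1 := mv (fun t => fst (F t)) (fun t => fst (f t))
  (fun t ht => (dF t ht).1) (fun t ht => Rle_trans _ _ _ (Rabs_fst_le _) (bf t ht)).
have H2 := mv (fun t => snd (F t)) (fun t => snd (f t))
  (fun t ht => (dF t ht).2) (fun t ht => Rle_trans _ _ _ (Rabs_snd_le _) (bf t ht)).
rewrite /=; lra.
Qed.

End ComplexIntegration.

(** * The slit plane and integrals from its centre *)

Section SlitPlane.
Local Open Scope R_scope.

(** A positive form of [slit_plane], suited to case analysis. *)
Definition slit (z : C) : Prop := snd z <> 0 \/ 0 < fst z < 1.

Lemma slitP (z : C) : slit_plane z <-> slit z.
Proof.
rewrite /slit_plane /slit /=; split.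
  move=> H; case: (Req_dec (snd z) 0) => [E|]; last by left.
  right; split; apply: Rnot_le_lt => L; apply: H; split => //.
    by left; apply/RleP.
  by right; apply/RleP.
move=> H [E [/RleP L|/RleP L]]; case: H => [//|[H1 H2]]; move: L H1 H2;
  rewrite /GRing.zero /GRing.one /= /Re; lra.
Qed.

Lemma slit_1m (z : C) : slit z -> slit (1 - z)%C.
Proof. by rewrite /slit /=; case=> H; [left|right]; lra. Qed.

Lemma slit_neq0 (z : C) : slit z -> z <> RtoC 0.
Proof. by move=> sz E; move: sz; rewrite E /slit /=; lra. Qed.

Lemma slit_neq1 (z : C) : slit z -> (1 - z)%C <> RtoC 0.
Proof. by move=> /slit_1m/slit_neq0. Qed.

Lemma slit_real (t : R) : 0 < t < 1 -> slit (RtoC t).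
Proof. by right. Qed.

Lemma open_slit (z : C) : slit z -> locally (z : C_UniformSpace) slit.
Proof.
case=> H.
  have p : 0 < Rabs (snd z) by apply: Rabs_pos_lt.
  exists (mkposreal _ p) => w [_ H2]; left => E; move: H2.
  rewrite /ball /= /AbsRing_ball /abs /Hierarchy.minus /Hierarchy.plus /Hierarchy.opp /=.
  by rewrite E Rplus_0_l Rabs_Ropp; lra.
have p : 0 < Rmin (fst z) (1 - fst z) by apply: Rmin_pos; lra.
exists (mkposreal _ p) => w [H1 _]; right; move: H1.
rewrite /ball /= /AbsRing_ball /abs /Hierarchy.minus /Hierarchy.plus /Hierarchy.opp /=.
have := Rmin_l (fst z) (1 - fst z); have := Rmin_r (fst z) (1 - fst z).
move=> a b /Rabs_def2; lra.
Qed.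

Definition center : C := RtoC (/ 2).

Lemma slit_star (z : C) (t : R) :
  slit z -> 0 <= t <= 1 -> slit (center + RtoC t * (z - center))%C.
Proof.
rewrite /slit /= => sz ht; case: (Req_dec (snd z) 0) => [E|N].
  case: sz => [//|sz]; right; nra.
case: (Req_dec t 0) => [->|nt]; first by right; lra.
left; rewrite Ropp_0 Rplus_0_r Rmult_0_l Rplus_0_r Rplus_0_l.
by apply: Rmult_integral_contrapositive.
Qed.

Definition contD (f : C -> C) : Prop :=
  forall z, slit z -> cts (U := C_UniformSpace) f z.

(** Complex differentiability, expressed by the derivatives along all real lines through z. This is
    what integration along segments uses; continuity of F does not come with it and is recovered
    from that of f in [hder_contD]. *)
Definition hder (F f : C -> C) : Prop :=
  forall z h, slit z -> cderiv (fun s => F (z + RtoC s * h)%C) 0 (f z * h)%C.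

Lemma hder_at (F f : C -> C) (z h : C) (t : R) :
  hder F f -> slit (z + RtoC t * h)%C ->
  cderiv (fun s => F (z + RtoC s * h)%C) t (f (z + RtoC t * h) * h)%C.
Proof.
move=> dF st.
apply: (cderiv_ext (f := fun s => F ((z + RtoC t * h) + RtoC (s - t) * h)%C)).
  by move=> s; congr F; rewrite RtoC_minus; ring.
have E : t - t = 0 by ring.
have D : is_derive (fun s => s - t) t 1 by auto_derive => //; ring.
apply: cderiv_eq (cderiv_comp (f := fun s => F ((z + RtoC t * h) + RtoC s * h)%C) D _) _.
  by rewrite E; apply: dF.
by ring.
Qed.

Lemma hder_const_eq (F : C -> C) (z : C) :
  hder F (fun=> RtoC 0) -> slit z -> F z = F center.
Proof.
move=> dF sz.
have := @cderiv0_const (fun t => F (center + RtoC t * (z - center))%C) 0 1.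
have -> : (center + RtoC 0 * (z - center))%C = center by ring.
have -> : (center + RtoC 1 * (z - center))%C = z by ring.
move=> -> //; first lra.
move=> t ht; apply: cderiv_eq (hder_at dF _) _; last by ring.
exact: slit_star.
Qed.

Lemma is_derive_RInt_unit (g dg : R -> R -> R) :
  locally 0 (fun s => forall t, 0 <= t <= 1 -> is_derive (g^~ t) s (dg s t)) ->
  (forall t, 0 <= t <= 1 -> locally_2d (fun u v => is_derive (g^~ v) u (dg u v)) 0 t) ->
  (forall t, 0 <= t <= 1 -> continuity_2d_pt dg 0 t) ->
  locally 0 (fun s => ex_RInt (g s) 0 1) ->
  is_derive (fun s => RInt (g s) 0 1) 0 (RInt (dg 0) 0 1).
Proof.
move=> H1 H2 H3 H4.
have m : Rmin 0 1 = 0 by rewrite Rmin_left; lra.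
have M : Rmax 0 1 = 1 by rewrite Rmax_right; lra.
apply: is_derive_eq (is_derive_RInt_param g 0 1 0 _ _ H4) _.
- apply: filter_imp H1 => s Hs t; rewrite m M => ht; eexists; exact: Hs.
- move=> t; rewrite m M => ht.
  apply: continuity_2d_pt_ext_loc (H3 t ht).
  apply: locally_2d_impl (H2 t ht).
  by apply: locally_2d_forall => u v D; apply/esym/is_derive_unique.
- apply: RInt_ext => t; rewrite m M => ht.
  apply: is_derive_unique; apply: (locally_singleton _ _ H1); lra.
Qed.

Definition ray (z : C) (t : R) : C := (center + RtoC t * (z - center))%C.

Definition segint (f : C -> C) (z : C) : C :=
  (RInt (fun t => fst (f (ray z t) * (z - center))%C) 0 1,
   RInt (fun t => snd (f (ray z t) * (z - center))%C) 0 1).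

(* Differentiating under the integral sign gives the integral over [0,1] of
   h * d/dt (t * f (center + t (z - center))). *)
Lemma hder_segint (f df : C -> C) :
  contD f -> contD df -> hder f df -> hder (segint f) f.
Proof.
move=> cf cdf Hf z h sz.
pose zs (s : R) : C := (z + RtoC s * h)%C.
pose g (s t : R) : C := (f (ray (zs s) t) * (zs s - center))%C.
pose dg (s t : R) : C :=
  (df (ray (zs s) t) * (RtoC t * h) * (zs s - center) + f (ray (zs s) t) * h)%C.
have rE s t : ray (zs s) t = (ray z t + RtoC s * (RtoC t * h))%C.
  by rewrite /ray /zs; ring.
have gD s t : slit (ray (zs s) t) -> cderiv (g^~ t) s (dg s t).
  move=> sr; rewrite /g /dg.
  have D1 : cderiv (fun s => f (ray (zs s) t)) s (df (ray (zs s) t) * (RtoC t * h))%C.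
    apply: (cderiv_ext (f := fun s => f (ray z t + RtoC s * (RtoC t * h))%C)).
      by move=> s'; rewrite rE.
    by rewrite rE; apply: hder_at => //; rewrite -rE.
  have D2 : cderiv (fun s => (zs s - center)%C) s h.
    apply: cderiv_eq (cderiv_plus (cderiv_affine z h s) (cderiv_const (- center)%C s)) _.
    by ring.
  exact: (cderiv_mult D1 D2).
have lz : locally 0 (fun s => slit (zs s)).
  have c0 : cts zs 0 := cts_affine z h 0.
  have z0 : zs 0 = z by rewrite /zs; ring.
  have [c1 c2] := c0.
  case: sz => sz.
    have H : locally (snd (zs 0)) (fun y => y <> 0) by apply: open_neq; rewrite z0.
    have H2 : locally 0 (fun s => snd (zs s) <> 0) := c2 _ H.
    by apply: filter_imp H2 => s Hs; left.
  have H : locally (fst (zs 0)) (fun y => 0 < y /\ y < 1).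
    by rewrite z0; apply: filter_and; [apply: open_gt|apply: open_lt]; lra.
  have H1 : locally 0 (fun s => 0 < fst (zs s) /\ fst (zs s) < 1) := c1 _ H.
  by apply: filter_imp H1 => s Hs; right.
pose U2 : UniformSpace := prod_UniformSpace R_UniformSpace R_UniformSpace.
have cf1 (u : U2) : cts (fun p : U2 => RtoC (fst p)) u.
  by case: u => a b; split; [apply: continuous_fst|apply: continuous_const].
have cs1 (u : U2) : cts (fun p : U2 => RtoC (snd p)) u.
  by case: u => a b; split; [apply: continuous_snd|apply: continuous_const].
have czs (u : U2) : cts (fun p : U2 => zs (fst p)) u.
  by apply: cts_plus; [apply: cts_const|apply: cts_mult => //; apply: cts_const].
have czc (u : U2) : cts (fun p : U2 => (zs (fst p) - center)%C) u.
  by apply: cts_plus => //; apply: cts_const.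
have cray (u : U2) : cts (fun p : U2 => ray (zs (fst p)) (snd p)) u.
  by apply: cts_plus; [apply: cts_const|apply: cts_mult].
have cdg (t : R) : 0 <= t <= 1 -> cts (fun p : U2 => dg (fst p) (snd p)) (0, t).
  move=> ht.
  have sr : slit (ray (zs 0) t).
    by apply: slit_star => //; apply: (locally_singleton _ _ lz).
  apply: cts_plus; apply: cts_mult => //; try exact: cts_const.
    apply: cts_mult; first by apply: (cts_comp (f := df)) => //; apply: cdf.
    by apply: cts_mult => //; apply: cts_const.
  by apply: (cts_comp (f := f)) => //; apply: cf.
have l2 (t : R) : 0 <= t <= 1 ->
    locally_2d (fun u v => slit (ray (zs u) v)) 0 t.
  move=> ht; apply/locally_2d_locally.
  have sr : slit (ray (zs 0) t).
    by apply: slit_star => //; apply: (locally_singleton _ _ lz).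
  have [e He] := open_slit sr.
  have [k1 k2] := cray (0, t).
  have h1 : locally (0, t) (fun p : U2 => ball (fst (ray (zs 0) t)) e
      (fst (ray (zs (fst p)) (snd p)))) := k1 _ (locally_ball _ e).
  have h2 : locally (0, t) (fun p : U2 => ball (snd (ray (zs 0) t)) e
      (snd (ray (zs (fst p)) (snd p)))) := k2 _ (locally_ball _ e).
  by refine (filter_imp _ _ _ (filter_and _ _ h1 h2)) => v ?; apply: He.
have cg s : slit (zs s) -> forall t, 0 <= t <= 1 -> cts (g s) t.
  move=> ss t ht; apply: cts_mult; last exact: cts_const.
  apply: (cts_comp (f := f)); first by apply/cf/slit_star.
  exact: cts_affine.
have m : Rmin 0 1 = 0 by rewrite Rmin_left; lra.
have M : Rmax 0 1 = 1 by rewrite Rmax_right; lra.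
have I1 : is_derive (fun s => RInt (fun t => fst (g s t)) 0 1) 0
   (RInt (fun t => fst (dg 0 t)) 0 1).
  apply: (is_derive_RInt_unit (g := fun s t => fst (g s t)) (dg := fun s t => fst (dg s t))).
  - by apply: filter_imp lz => s ss t ht; apply: (gD s t _).1; apply: slit_star.
  - move=> t ht; apply: locally_2d_impl (l2 t ht).
    by apply: locally_2d_forall => u v /gD[].
  - by move=> t /cdg [c1 c2]; apply/continuity_2d_pt_filterlim.
  - apply: filter_imp lz => s ss; apply: (ex_RInt_continuous (V := R_CompleteNormedModule)).
    by move=> t; rewrite m M => /(cg s ss)[].
have I2 : is_derive (fun s => RInt (fun t => snd (g s t)) 0 1) 0
   (RInt (fun t => snd (dg 0 t)) 0 1).
  apply: (is_derive_RInt_unit (g := fun s t => snd (g s t)) (dg := fun s t => snd (dg s t))).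
  - by apply: filter_imp lz => s ss t ht; apply: (gD s t _).2; apply: slit_star.
  - move=> t ht; apply: locally_2d_impl (l2 t ht).
    by apply: locally_2d_forall => u v /gD[].
  - by move=> t /cdg [c1 c2]; apply/continuity_2d_pt_filterlim.
  - apply: filter_imp lz => s ss; apply: (ex_RInt_continuous (V := R_CompleteNormedModule)).
    by move=> t; rewrite m M => /(cg s ss)[].
have z0 : zs 0 = z by rewrite /zs; ring.
have dgI : is_CInt (dg 0) 0 1 (f z * h)%C.
  have := @is_CInt_derive (fun t => RtoC t * f (ray z t) * h)%C (dg 0) 0 1 Rle_0_1.
  have -> : (RtoC 1 * f (ray z 1) * h - RtoC 0 * f (ray z 0) * h)%C = (f z * h)%C.
    have -> : ray z 1 = z by rewrite /ray; ring.
    by ring.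
  apply.
    move=> t ht.
    have D1 : cderiv (fun t => RtoC t) t (RtoC 1).
      by split; [apply: (is_derive_id (K := R_AbsRing))|apply: is_derive_const].
    have D2 : cderiv (fun t => f (ray z t)) t (df (ray z t) * (z - center))%C.
      by apply: hder_at => //; apply: slit_star.
    apply: cderiv_eq (cderiv_mult (cderiv_mult D1 D2) (cderiv_const h t)) _.
    by rewrite /dg z0; ring.
  move=> t ht.
  have [c1 c2] := cdg t ht.
  have lim : filterlim (fun t : R => ((0, t) : U2)) (locally t) (locally ((0, t) : U2)).
    by move=> P [e He]; exists e => y hy; apply: He; split => //; apply: ball_center.
  by split; [exact: (filterlim_comp _ _ _ _ _ _ _ _ lim c1)|
             exact: (filterlim_comp _ _ _ _ _ _ _ _ lim c2)].
split.
  by apply: is_derive_eq I1 _; apply: is_RInt_unique dgI.1.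
by apply: is_derive_eq I2 _; apply: is_RInt_unique dgI.2.
Qed.

End SlitPlane.

(** * Polylogarithms *)

Section WordSeries.
Local Open Scope R_scope.

(* The coefficients of Li(w; z) as a power series in z, for w in h^1; they
   vanish for the other words. *)
Fixpoint coef (w : word) (n : nat) : R :=
  match w, n with
  | [::], O => 1
  | [::], S _ => 0
  | _ :: _, O => 0
  | lx :: w', S m => coef w' n / INR n
  | ly :: w', S m => sum_f_R0 (coef w') m / INR n
  end.

Lemma coef0 (l : letter) (w : word) : coef (l :: w) 0 = 0.
Proof. by case: l. Qed.

Lemma coef_x (w : word) (n : nat) : coef (lx :: w) n.+1 = coef w n.+1 / INR n.+1.
Proof. by []. Qed.

Lemma coef_y (w : word) (n : nat) :
  coef (ly :: w) n.+1 = sum_f_R0 (coef w) n / INR n.+1.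
Proof. by []. Qed.

(** At index n + 1, the letter x divides by n + 1 and the letter y averages n + 1 earlier
    coefficients; both preserve the interval [0,1]. *)
Lemma coef_ge0_le1 (w : word) (n : nat) : 0 <= coef w n <= 1.
Proof.
elim: w n => [|l w IH] [|n]; try by case: l => /=; split; lra.
- by move=> /=; split; lra.
- by move=> /=; split; lra.
have n0 : 0 < INR n.+1 by apply: lt_0_INR; apply/ltP.
have n1 : 1 <= INR n.+1 by rewrite S_INR; have := pos_INR n; lra.
have nz : INR n.+1 <> 0 by lra.
have H (c : R) : 0 <= c <= INR n.+1 -> 0 <= c / INR n.+1 <= 1.
  move=> hc; split; first by apply: Rdiv_le_0_compat; lra.
  by apply/(Rdiv_le_1 _ _ n0); lra.
case: l; rewrite (coef_x, coef_y); apply: H.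
  by have := IH n.+1; lra.
elim: n {n0 n1 nz} => [|n IHn]; first by have := IH 0%N; rewrite /=; lra.
by rewrite tech5 S_INR; have := IH n.+1; lra.
Qed.

Definition wseries (w : word) (z : C) : C :=
  (Series (fun n => coef w n * fst (z ^+ n)%R),
   Series (fun n => coef w n * snd (z ^+ n)%R)).

Definition is_CSer (u : nat -> C) (l : C) : Prop :=
  is_series (fun n => fst (u n)) (fst l) /\ is_series (fun n => snd (u n)) (snd l).

Lemma is_CSer_ext (u v : nat -> C) (l : C) :
  (forall n, u n = v n) -> is_CSer u l -> is_CSer v l.
Proof.
by move=> uv [u1 u2]; split; [apply: is_series_ext u1|apply: is_series_ext u2] => n;
  rewrite uv.
Qed.

Lemma is_CSer_minus (u v : nat -> C) (l m : C) :
  is_CSer u l -> is_CSer v m -> is_CSer (fun n => (u n - v n)%C) (l - m)%C.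
Proof. by move=> [u1 u2] [v1 v2]; split; apply: is_series_minus. Qed.

Lemma is_CSer_scal (c : C) (u : nat -> C) (l : C) :
  is_CSer u l -> is_CSer (fun n => (c * u n)%C) (c * l)%C.
Proof.
move=> [u1 u2]; split => /=.
  exact: is_series_minus (is_series_scal (fst c) _ _ u1) (is_series_scal (snd c) _ _ u2).
exact: is_series_plus (is_series_scal (fst c) _ _ u2) (is_series_scal (snd c) _ _ u1).
Qed.

Lemma is_CSer_unique (u : nat -> C) (l m : C) : is_CSer u l -> is_CSer u m -> l = m.
Proof.
move=> [u1 u2] [v1 v2]; rewrite [l]surjective_pairing [m]surjective_pairing.
by rewrite -(is_series_unique _ _ u1) -(is_series_unique _ _ u2)
  -(is_series_unique _ _ v1) -(is_series_unique _ _ v2).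
Qed.

Lemma is_CSer_shift (u : nat -> C) (l : C) :
  u 0%N = RtoC 0 -> is_CSer u l <-> is_CSer (fun n => u n.+1) l.
Proof.
move=> u0; split=> [] [u1 u2]; split.
- apply: (is_series_incr_1 (fun n => fst (u n))).
  by rewrite u0 /Hierarchy.plus /= Rplus_0_r.
- apply: (is_series_incr_1 (fun n => snd (u n))).
  by rewrite u0 /Hierarchy.plus /= Rplus_0_r.
- apply: (is_series_decr_1 (fun n => fst (u n))).
  by rewrite u0 /Hierarchy.plus /Hierarchy.opp /= Ropp_0 Rplus_0_r.
- apply: (is_series_decr_1 (fun n => snd (u n))).
  by rewrite u0 /Hierarchy.plus /Hierarchy.opp /= Ropp_0 Rplus_0_r.
Qed.

Lemma CpowS (z : C) (n : nat) : (z ^+ n.+1)%R = (z * (z ^+ n)%R)%C.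
Proof. exact: exprS. Qed.

Lemma Cmod_pow (z : C) (n : nat) : Cmod (z ^+ n)%R = Cmod z ^ n.
Proof.
elim: n => [|n IH]; first by rewrite expr0 -[X in Cmod X]/(RtoC 1) Cmod_1.
by rewrite CpowS Cmod_mult IH.
Qed.

Lemma Cpow_scal (t : R) (z : C) (n : nat) :
  ((RtoC t * z)%C ^+ n)%R = (RtoC (t ^ n) * (z ^+ n)%R)%C.
Proof.
elim: n => [|n IH]; first by rewrite !expr0 -[1%R]/(RtoC 1) /=; ring.
by rewrite !CpowS IH /= RtoC_mult; ring.
Qed.

(** Used along the ray from 0 to z with r = |z| < 1: the endpoint t = 1 is then interior to the disc
    of convergence, and termwise differentiation is valid on all of [0,1]. *)
Lemma CV_radius_gt1 (a : nat -> R) (r : R) :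
  0 <= r < 1 -> (forall n, Rabs (a n) <= r ^ n) ->
  forall t, 0 <= t <= 1 -> Rbar_lt (Rabs t) (CV_radius a).
Proof.
move=> r01 Ha t ht.
(* What is needed is 1 < q and r q <= 1; this choice also covers r = 0, where 1/r would not do. *)
set q := 2 / (1 + r).
have q0 : 0 < q by apply: Rdiv_lt_0_compat; lra.
have qE : q * (1 + r) = 2 by rewrite /q; field; lra.
have q1 : 1 < q by nra.
have qr : r * q <= 1 by nra.
have [ub _] := CV_radius_bounded a.
rewrite (Rabs_pos_eq t); last lra.
apply: (Rbar_lt_le_trans _ (Rbar.Finite q)); first by rewrite /=; lra.
apply: ub; exists 1 => n; rewrite Rabs_mult -RPow_abs (Rabs_pos_eq q); last lra.
apply: (Rle_trans _ (r ^ n * q ^ n)).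
  by apply: Rmult_le_compat_r (Ha n); apply: pow_le; lra.
rewrite -Rpow_mult_distr -(pow1 n); apply: pow_incr; split=> //.
by apply: Rmult_le_pos; lra.
Qed.

Lemma fst_scal (x : R) (w : C) : fst (RtoC x * w)%C = x * fst w.
Proof. by move=> /=; ring. Qed.

Lemma snd_scal (x : R) (w : C) : snd (RtoC x * w)%C = x * snd w.
Proof. by move=> /=; ring. Qed.

Lemma coef_pow_le (w : word) (z : C) (n : nat) :
  Rabs (coef w n * fst (z ^+ n)%R) <= Cmod z ^ n /\
  Rabs (coef w n * snd (z ^+ n)%R) <= Cmod z ^ n.
Proof.
have [c0 c1] := coef_ge0_le1 w n.
rewrite !Rabs_mult (Rabs_pos_eq (coef w n)) // -Cmod_pow.
have le x M : Rabs x <= M -> coef w n * Rabs x <= M.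
  by have := Rabs_pos x; nra.
by split; apply: le; [apply: Rabs_fst_le|apply: Rabs_snd_le].
Qed.

Lemma is_pseries_pow (a : nat -> R) (t : R) :
  Rbar_lt (Rabs t) (CV_radius a) -> is_series (fun n => a n * t ^ n) (PSeries a t).
Proof.
move=> /CV_radius_inside/PSeries_correct; rewrite /is_pseries.
by apply: is_series_ext => n; rewrite pow_n_pow /scal /= /mult /= Rmult_comm.
Qed.

Section Ray.
Variable z : C.
Hypothesis z1 : Cmod z < 1.

Let rad w t (t01 : 0 <= t <= 1) :
  Rbar_lt (Rabs t) (CV_radius (fun n => coef w n * fst (z ^+ n)%R)) /\
  Rbar_lt (Rabs t) (CV_radius (fun n => coef w n * snd (z ^+ n)%R)).
Proof.
have z0 := Cmod_ge_0 z.
by split; apply: (CV_radius_gt1 (r := Cmod z)) => // n; have [] := coef_pow_le w z n.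
Qed.

(** Restricted to a ray, each component is a real power series in t, so the real theory of power
    series gives its derivative. *)
Lemma wseries_ray (w : word) (t : R) :
  wseries w (RtoC t * z)%C =
  (PSeries (fun n => coef w n * fst (z ^+ n)%R) t,
   PSeries (fun n => coef w n * snd (z ^+ n)%R) t).
Proof.
by congr pair; apply: Series_ext => n; rewrite Cpow_scal /=; ring.
Qed.

Lemma is_CSer_wseries (w : word) (t : R) : 0 <= t <= 1 ->
  is_CSer (fun n => (RtoC (coef w n * t ^ n) * (z ^+ n)%R)%C) (wseries w (RtoC t * z)%C).
Proof.
move=> t01; have [r1 r2] := rad w t01; rewrite wseries_ray.
split; [apply: is_series_ext (is_pseries_pow r1)|apply: is_series_ext (is_pseries_pow r2)]
  => n /=; ring.
Qed.

Definition dwseries (w : word) (t : R) : C :=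
  (PSeries (PS_derive (fun n => coef w n * fst (z ^+ n)%R)) t,
   PSeries (PS_derive (fun n => coef w n * snd (z ^+ n)%R)) t).

Lemma cderiv_wseries (w : word) (t : R) : 0 <= t <= 1 ->
  cderiv (fun s => wseries w (RtoC s * z)%C) t (dwseries w t).
Proof.
move=> t01; have [r1 r2] := rad w t01.
apply: cderiv_ext; first by move=> s; rewrite wseries_ray.
by split; apply: is_derive_PSeries.
Qed.

Lemma cts_dwseries (w : word) (t : R) : 0 <= t <= 1 -> cts (dwseries w) t.
Proof.
move=> t01; have [r1 r2] := rad w t01.
by split; apply/continuity_pt_filterlim/PSeries_continuity; rewrite CV_radius_derive.
Qed.

Lemma is_CSer_dwseries (w : word) (t : R) : 0 <= t <= 1 ->
  is_CSer (fun n => (RtoC (INR n.+1 * coef w n.+1 * t ^ n) * (z ^+ n.+1)%R)%C)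
          (dwseries w t).
Proof.
move=> t01; have [r1 r2] := rad w t01.
rewrite -CV_radius_derive in r1; rewrite -CV_radius_derive in r2.
split; [apply: is_series_ext (is_pseries_pow r1)|apply: is_series_ext (is_pseries_pow r2)]
  => n; rewrite /PS_derive (fst_scal, snd_scal) -[eq]/(@eq R); ring.
Qed.

(** Differentiation multiplies coefficient n by n and cancels the division made by the letter x. The
    word after x is nonempty, so its series has no constant term to be lost. *)
Lemma dwseries_x (l : letter) (w : word) (t : R) : 0 <= t <= 1 ->
  (RtoC t * dwseries (lx :: l :: w) t)%C = wseries (l :: w) (RtoC t * z)%C.
Proof.
move=> t01; apply: is_CSer_unique (is_CSer_scal _ (is_CSer_dwseries _ t01)) _.
have /is_CSer_shift := is_CSer_wseries (l :: w) t01.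
rewrite coef0 => H; have {}H := H _; apply: is_CSer_ext (H _) => [n|].
  have nz : INR n.+1 <> 0 by apply: not_0_INR.
  rewrite coef_x Cmult_assoc -RtoC_mult; congr (RtoC _ * _)%C.
  by rewrite /=; field.
by rewrite Rmult_0_l Cmult_0_l.
Qed.

(** The derivative has the partial sums of [coef w] as coefficients, and multiplication by 1 - t z
    takes differences of consecutive ones. *)
Lemma dwseries_y (w : word) (t : R) : 0 <= t <= 1 ->
  ((1 - RtoC t * z) * dwseries (ly :: w) t)%C = (z * wseries w (RtoC t * z))%C.
Proof.
move=> t01; have H := is_CSer_dwseries (ly :: w) t01.
have H2 := is_CSer_scal z (is_CSer_wseries w t01).
(* The derivative multiplied by t z, shifted by one so that its term of index n carries the same
   power of t z as the term of index n of the derivative. *)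
pose v n := if n is m.+1 then (RtoC t * z *
  (RtoC (INR m.+1 * coef (ly :: w) m.+1 * t ^ m) * (z ^+ m.+1)%R))%C else RtoC 0.
have Hv : is_CSer v (RtoC t * z * dwseries (ly :: w) t)%C.
  by apply/is_CSer_shift => //; apply: is_CSer_scal H.
have -> : ((1 - RtoC t * z) * dwseries (ly :: w) t)%C =
          (dwseries (ly :: w) t - RtoC t * z * dwseries (ly :: w) t)%C by ring.
apply: is_CSer_unique (is_CSer_minus H Hv) _; apply: is_CSer_ext H2 => n.
have nz m : INR m.+1 <> 0 by apply: not_0_INR.
have E m : INR m.+1 * coef (ly :: w) m.+1 = sum_f_R0 (coef w) m.
  by rewrite coef_y; field.
rewrite E CpowS; case: n => [|n]; first by rewrite /v /=; ring.
rewrite /v E tech5 -tech_pow_Rmult !CpowS !RtoC_mult !RtoC_plus.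
by ring.
Qed.

End Ray.

End WordSeries.

(** * Iterated integrals in the unit disc *)

Section IteratedIntegrals.
Local Open Scope R_scope.

(** The default [ly] places the empty word in h^1, so that h^1 is stable under removal of the first
    letter. *)
Definition h1 (w : word) : Prop := last ly w = ly.

Lemma h1_behead (l : letter) (w : word) : h1 (l :: w) -> h1 w.
Proof. by case: w. Qed.

Lemma h1_x (w : word) : h1 (lx :: w) -> exists l w', w = l :: w'.
Proof. by case: w => // l w' _; exists l, w'. Qed.

Lemma omega_x (s : C) : omega lx s = (/ s)%C. Proof. by []. Qed.

Lemma omega_y (s : C) : omega ly s = (/ (1 - s))%C. Proof. by []. Qed.

Lemma iterated_int_cons (l : letter) (w : word) (z : C) :
  iterated_int (l :: w) z = segment_int (fun s => (omega l s * iterated_int w s)%C) z.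
Proof. by []. Qed.

Lemma Cmod_scal (t : R) (z : C) : 0 <= t -> Cmod (RtoC t * z)%C = t * Cmod z.
Proof. by move=> t0; rewrite Cmod_mult Cmod_R Rabs_pos_eq. Qed.

Lemma Cmod_lt1_neq (s : C) : Cmod s < 1 -> (1 - s)%C <> RtoC 0.
Proof.
move=> s1 E; have Es : s = RtoC 1.
  have -> : s = (RtoC 1 - (1 - s))%C by ring.
  by rewrite E; ring.
by move: s1; rewrite Es Cmod_1; lra.
Qed.

Lemma wseries_nil (z : C) : wseries [::] z = RtoC 1.
Proof.
have H (g : nat -> R) : Series (fun n => coef [::] n * g n) = g 0%N.
  apply: is_series_unique; apply: (is_lim_seq_ext (fun=> g 0%N)) (is_lim_seq_const _).
  elim=> [|n IH]; first by rewrite sum_O -[eq]/(@eq R) /=; ring.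
  by rewrite sum_Sn -IH /Hierarchy.plus -[eq]/(@eq R) /=; ring.
by rewrite /wseries !H expr0.
Qed.

Lemma wseries0 (l : letter) (w : word) : wseries (l :: w) (RtoC 0) = RtoC 0.
Proof.
have H (g : nat -> R) : Series (fun n => coef (l :: w) n * (0 * g n)) = 0.
  apply: is_series_unique; apply: (is_lim_seq_ext (fun=> 0)) (is_lim_seq_const _).
  elim=> [|n IH]; first by rewrite sum_O -[eq]/(@eq R) /=; ring.
  by rewrite sum_Sn -IH /Hierarchy.plus -[eq]/(@eq R) /=; ring.
have E n : coef (l :: w) n = 0 \/ ((RtoC 0) ^+ n)%R = RtoC 0.
  case: n => [|n]; first by left; rewrite coef0.
  by right; rewrite CpowS Cmult_0_l.
congr pair; rewrite -[RHS](H (fun=> 0)); apply: Series_ext => n;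
  by case: (E n) => ->; rewrite /=; ring.
Qed.

(** The constant term is 0, and |z|^n <= 2 |z| (1/2)^n for n >= 1. The geometric series from n = 0
    sums to 4 |z|, and the two components together give 8 |z|. *)
Lemma wseries_bound (l : letter) (w : word) (z : C) :
  Cmod z <= / 2 -> Cmod (wseries (l :: w) z) <= 8 * Cmod z.
Proof.
move=> z2; have z0 := Cmod_ge_0 z.
have [Eb eb] : Series (fun n => 2 * Cmod z * (/ 2) ^ n) = 4 * Cmod z /\
    ex_series (fun n => 2 * Cmod z * (/ 2) ^ n).
  have G : is_series (fun n => (/ 2) ^ n) (/ (1 - / 2)).
    by apply: is_series_geom; rewrite Rabs_pos_eq; lra.
  have G2 := is_series_scal (2 * Cmod z) _ _ G.
  split; last by eexists; exact: G2.
  apply: is_series_unique; move: G2.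
  suff -> : 4 * Cmod z = scal (2 * Cmod z) (/ (1 - / 2)) by [].
  by rewrite /scal /= /mult /=; field.
have H (g : nat -> R) : (forall n, Rabs (g n) <= Cmod z ^ n) ->
    Rabs (Series (fun n => coef (l :: w) n * g n)) <= 4 * Cmod z.
  move=> gb.
  have le n : 0 <= Rabs (coef (l :: w) n * g n) <= 2 * Cmod z * (/ 2) ^ n.
    split; first exact: Rabs_pos.
    case: n => [|n]; first by rewrite coef0 Rmult_0_l Rabs_R0 pow_O; lra.
    have [c0 c1] := coef_ge0_le1 (l :: w) n.+1.
    rewrite Rabs_mult Rabs_pos_eq //.
    have p : Cmod z ^ n <= (/ 2) ^ n by apply: pow_incr.
    have := gb n.+1; have := Rabs_pos (g n.+1).
    rewrite -!tech_pow_Rmult => g0 gn.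
    apply: (Rle_trans _ (Cmod z * Cmod z ^ n)); first by nra.
    by nra.
  have ea := ex_series_le (V := R_CompleteNormedModule)
    (fun n => Rabs (coef (l :: w) n * g n)) _ (fun n => _) eb.
  have {}ea : ex_series (fun n => Rabs (coef (l :: w) n * g n)).
    apply: ea => n; rewrite /norm /= /abs /= Rabs_Rabsolu; exact: (le n).2.
  apply: Rle_trans (Series_Rabs _ ea) _.
  by rewrite -Eb; apply: Series_le.
have Hp (n : nat) := Cmod_pow z n.
have H1 := H (fun n => fst (z ^+ n)%R).
have H2 := H (fun n => snd (z ^+ n)%R).
apply: Rle_trans (Cmod_le_abs _) _.
have {}H1 := H1 (fun n => Rle_trans _ _ _ (Rabs_fst_le _) (Req_le _ _ (Hp n))).
have {}H2 := H2 (fun n => Rle_trans _ _ _ (Rabs_snd_le _) (Req_le _ _ (Hp n))).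
apply: (Rle_trans _ (4 * Cmod z + 4 * Cmod z)); last lra.
exact: Rplus_le_compat.
Qed.

Lemma dwseriesE (l : letter) (w : word) (z : C) (t : R) :
  h1 (l :: w) -> Cmod z < 1 -> 0 < t <= 1 ->
  dwseries z (l :: w) t = (omega l (RtoC t * z) * wseries w (RtoC t * z) * z)%C.
Proof.
move=> hw z1 t01; have t0 : RtoC t <> RtoC 0 by move=> /RtoC_inj; lra.
have t01' : 0 <= t <= 1 by lra.
case: l hw => hw.
  have [l' [w' E]] := h1_x hw; rewrite E in hw *.
  have H := dwseries_x z1 l' w' t01'.
  rewrite omega_x; case: (Ceq_dec z (RtoC 0)) => [z0|nz].
    move: H; rewrite z0 Cmult_0_r wseries0 => H.
    rewrite Cmult_0_r; have -> : dwseries (RtoC 0) [:: lx, l' & w'] t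
      = (/ RtoC t * (RtoC t * dwseries (RtoC 0) [:: lx, l' & w'] t))%C by field.
    by rewrite H Cmult_0_r.
  by rewrite -H; field.
have H := dwseries_y z1 w t01'.
have nz : (1 - RtoC t * z)%C <> RtoC 0.
  apply: Cmod_lt1_neq; rewrite Cmod_scal; last lra.
  by have := Cmod_ge_0 z; nra.
rewrite omega_y -Cmult_assoc [(wseries _ _ * z)%C]Cmult_comm -H; field.
exact: nz.
Qed.

(** The fundamental theorem of calculus along the ray. The integrands are compared on the open
    interval, so the value of the forms at s = 0 does not matter. *)
Lemma iterated_int_disk (w : word) (z : C) :
  h1 w -> Cmod z < 1 -> iterated_int w z = wseries w z.
Proof.
elim: w z => [|l w IH] z hw z1; first by rewrite wseries_nil.
rewrite iterated_int_cons; apply: segment_intE.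
have := is_CInt_derive Rle_0_1 (cderiv_wseries z1 (l :: w)) (cts_dwseries z1 (l :: w)).
have -> : (wseries (l :: w) (RtoC 1 * z) - wseries (l :: w) (RtoC 0 * z))%C
          = wseries (l :: w) z.
  by rewrite Cmult_1_l Cmult_0_l wseries0; ring.
apply: (is_CInt_ext Rle_0_1) => t t01.
rewrite dwseriesE //; last lra.
rewrite IH //; first exact: h1_behead hw.
by rewrite Cmod_scal; have := Cmod_ge_0 z; nra.
Qed.

End IteratedIntegrals.

(** * Calculus of complex derivatives on the slit plane *)

Section Holomorphy.
Local Open Scope R_scope.

Lemma hder_ext (F G f g : C -> C) :
  (forall z, slit z -> F z = G z) -> (forall z, slit z -> f z = g z) ->
  hder F f -> hder G g.
Proof.
move=> FG fg dF z h sz; rewrite -fg //.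
apply: cderiv_ext_loc (dF z h sz).
have c0 : cts (fun s : R => (z + RtoC s * h)%C) 0 := cts_affine z h 0.
have E0 : (z + RtoC 0 * h)%C = z by ring.
have l0 : locally (z + RtoC 0 * h : C_UniformSpace)%C slit by rewrite E0; apply: open_slit.
have [e He] := l0; have [k1 k2] := c0.
have h1 : locally 0 (fun s : R => ball (fst (z + RtoC 0 * h)%C) e
    (fst (z + RtoC s * h)%C)) := k1 _ (locally_ball _ e).
have h2 : locally 0 (fun s : R => ball (snd (z + RtoC 0 * h)%C) e
    (snd (z + RtoC s * h)%C)) := k2 _ (locally_ball _ e).
by refine (filter_imp _ _ _ (filter_and _ _ h1 h2)) => s hs; apply/FG/He.
Qed.

Lemma contD_ext (F G : C -> C) :
  (forall z, slit z -> F z = G z) -> contD F -> contD G.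
Proof.
move=> FG cF z sz; apply: cts_ext_loc (cF z sz).
by apply: filter_imp (open_slit sz) => w; apply: FG.
Qed.

Lemma hder_plus (F G f g : C -> C) :
  hder F f -> hder G g -> hder (fun z => (F z + G z)%C) (fun z => (f z + g z)%C).
Proof.
move=> dF dG z h sz.
by apply: cderiv_eq (cderiv_plus (dF z h sz) (dG z h sz)) _; ring.
Qed.

Lemma hder_const (c : C) : hder (fun=> c) (fun=> RtoC 0).
Proof.
by move=> z h sz; apply: cderiv_eq (cderiv_const c 0) _; rewrite Cmult_0_l.
Qed.

Lemma hder_mult (F G f g : C -> C) :
  hder F f -> hder G g ->
  hder (fun z => (F z * G z)%C) (fun z => (f z * G z + F z * g z)%C).
Proof.
move=> dF dG z h sz; have E : (z + RtoC 0 * h)%C = z by ring.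
apply: cderiv_eq (cderiv_mult (dF z h sz) (dG z h sz)) _.
by rewrite E; ring.
Qed.

Lemma hder_comp_1m (F f : C -> C) :
  hder F f -> hder (fun z => F (1 - z)%C) (fun z => (- f (1 - z))%C).
Proof.
move=> dF z h sz; have := dF (1 - z)%C (- h)%C (slit_1m sz).
have -> : (f (1 - z) * - h)%C = (- f (1 - z) * h)%C by ring.
by apply: cderiv_ext => s; congr F; ring.
Qed.

Lemma contD_mult (f g : C -> C) :
  contD f -> contD g -> contD (fun z => (f z * g z)%C).
Proof. by move=> cf cg z sz; apply: cts_mult; [apply: cf|apply: cg]. Qed.

Lemma contD_plus (f g : C -> C) :
  contD f -> contD g -> contD (fun z => (f z + g z)%C).
Proof. by move=> cf cg z sz; apply: cts_plus; [apply: cf|apply: cg]. Qed.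

Lemma cts_id (z : C) : cts (U := C_UniformSpace) (fun w : C => w) z.
Proof. by case: z => a b; split; [apply: continuous_fst|apply: continuous_snd]. Qed.

Definition domega (l : letter) (s : C) : C :=
  if l is lx then (- (/ (s * s)))%C else (/ ((1 - s) * (1 - s)))%C.

Lemma contD_omega (l : letter) : contD (omega l).
Proof.
move=> z sz; case: l.
  by apply: cts_inv; [apply: slit_neq0|apply: cts_id].
apply: cts_inv; first exact: slit_neq1.
have cid := cts_id z.
apply: (cts_ext_loc (f := fun w => (RtoC 1 + (- RtoC 1)%C * w)%C)).
  by apply: filter_forall => w; change (RtoC 1 + (- RtoC 1)%C * w = RtoC 1 - w)%C; ring.
apply: cts_plus; first exact: cts_const.
by apply: cts_mult => //; apply: cts_const.
Qed.

Lemma domegaE (l : letter) (s : C) : slit s ->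
  domega l s = ((if l is lx then (- RtoC 1)%C else RtoC 1) * (omega l s * omega l s))%C.
Proof.
move=> ss; have n0 := slit_neq0 ss; have n1 := slit_neq1 ss.
case: l => /=.
  change (- / (s * s) = (- RtoC 1)%C * (/ s * / s))%C.
  by field.
by change (/ ((1 - s) * (1 - s)) = RtoC 1 * (/ (1 - s) * / (1 - s)))%C; field.
Qed.

Lemma contD_domega (l : letter) : contD (domega l).
Proof.
apply: (contD_ext (F := fun s => ((if l is lx then (- RtoC 1)%C else RtoC 1) *
                                  (omega l s * omega l s))%C)).
  by move=> s ss; rewrite domegaE.
by do 2?apply: contD_mult; try exact: contD_omega; move=> z sz; apply: cts_const.
Qed.

Lemma hder_omega (l : letter) : hder (omega l) (domega l).
Proof.
move=> z h sz; have n0 := slit_neq0 sz; have n1 := slit_neq1 sz.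
have E : (z + RtoC 0 * h)%C = z by ring.
case: l.
  have nE : (z + RtoC 0 * h)%C <> RtoC 0 by rewrite E.
  apply: cderiv_eq (cderiv_inv nE (cderiv_affine z h 0)) _.
  by rewrite E /domega; field.
have nE : ((1 - z) + RtoC 0 * (- h))%C <> RtoC 0 by move: n1; congr (_ <> _); ring.
apply: cderiv_ext (cderiv_eq (cderiv_inv nE (cderiv_affine (1 - z)%C (- h)%C 0)) _).
  by move=> s; rewrite omega_y; congr Cinv; ring.
have -> : (1 - z + RtoC 0 * - h)%C = (1 - z)%C by ring.
by rewrite /domega; field.
Qed.

(** Near z the function f is bounded, so the increment estimate along the segment from z to w makes
    F Lipschitz at z. *)
Lemma hder_contD (F f : C -> C) : hder F f -> contD f -> contD F.
Proof.
move=> dF cf z sz.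
have [e1 He1] := open_slit sz.
have [c1 c2] := cf z sz.
have [e2 He2] : locally (z : C_UniformSpace) (fun w => ball (fst (f z)) (mkposreal _ Rlt_0_1) (fst (f w))).
  exact: (c1 _ (locally_ball _ _)).
have [e3 He3] : locally (z : C_UniformSpace) (fun w => ball (snd (f z)) (mkposreal _ Rlt_0_1) (snd (f w))).
  exact: (c2 _ (locally_ball _ _)).
(* Near z each component of f differs by less than 1 from its value at z, whose modulus is at most
   |f z|; the sum of the two components is below M. *)
pose M := Cmod (f z) + Cmod (f z) + 2.
have M0 : 0 < M by rewrite /M; have := Cmod_ge_0 (f z); lra.
have Hd : locally (z : C_UniformSpace) (fun w => Cmod (F w - F z)%C <= 2 * (M * Cmod (w - z)%C)).
  have p : 0 < Rmin e1 (Rmin e2 e3).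
    by do 2?apply: Rmin_pos; apply: cond_pos.
  exists (mkposreal _ p) => w [/= b1 b2].
  have le1 := Rmin_l e1 (Rmin e2 e3); have le2 := Rmin_r e1 (Rmin e2 e3).
  have le3 := Rmin_l e2 e3; have le4 := Rmin_r e2 e3.
  have bt (t e : R) : 0 <= t <= 1 -> Rmin e1 (Rmin e2 e3) <= e ->
      ball (z : C_UniformSpace) e (z + RtoC t * (w - z))%C.
    move=> ht he; move: b1 b2; rewrite /ball /= /AbsRing_ball /abs /Hierarchy.minus
      /Hierarchy.plus /Hierarchy.opp /= => b1 b2.
    have aux a b : Rabs (b + - a) < Rmin e1 (Rmin e2 e3) -> Rabs (t * (b + - a)) < e.
      move=> h; rewrite Rabs_mult (Rabs_pos_eq t); last lra.
      by have := Rabs_pos (b + - a); nra.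
    have := aux _ _ b1; have := aux _ _ b2 => B2 B1.
    split.
      change (Rabs (fst (z + RtoC t * (w - z))%C - fst z) < e).
      by move: B1; congr (Rabs _ < _) => /=; ring.
    change (Rabs (snd (z + RtoC t * (w - z))%C - snd z) < e).
    by move: B2; congr (Rabs _ < _) => /=; ring.
  have := @cderiv_increment (fun t => F (z + RtoC t * (w - z))%C)
     (fun t => f (z + RtoC t * (w - z)) * (w - z))%C (M * Cmod (w - z)%C).
  have -> : (z + RtoC 1 * (w - z))%C = w by ring.
  have -> : (z + RtoC 0 * (w - z))%C = z by ring.
  apply=> t ht.
    by apply: hder_at => //; apply/He1/bt; lra.
  rewrite Cmod_mult; apply: Rmult_le_compat_r; first exact: Cmod_ge_0.
  have := He2 _ (bt t e2 ht ltac:(lra)); have := He3 _ (bt t e3 ht ltac:(lra)).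
  rewrite /ball /= /AbsRing_ball /abs /Hierarchy.minus /Hierarchy.plus /Hierarchy.opp /=.
  set u := f _ => B3 B2.
  apply: Rle_trans (Cmod_le_abs _) _; rewrite /M.
  have := Rabs_fst_le (f z); have := Rabs_snd_le (f z).
  move: B2 B3; rewrite /Rabs; do 6?case: Rcase_abs; lra.
(* Balls of C are squares: if both components of w - z are below e / (8 M), then |w - z| is below e
   / (4 M), which is less than the e / (2 M) required. *)
have p4 (e : posreal) : 0 < e / (8 * M).
  by apply: Rdiv_lt_0_compat; [apply: cond_pos|lra].
have key (e : posreal) : locally (z : C_UniformSpace) (fun w => Cmod (F w - F z)%C < e).
  have Hs : locally (z : C_UniformSpace) (fun w => Cmod (w - z)%C < e / (2 * M)).
    exists (mkposreal _ (p4 e)) => w [/= b1 b2]; move: b1 b2.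
    rewrite /ball /= /AbsRing_ball /abs /Hierarchy.minus /Hierarchy.plus /Hierarchy.opp /=.
    move=> b1 b2; apply: Rle_lt_trans (Cmod_le_abs _) _ => /=.
    have -> : e / (2 * M) = 4 * (e / (8 * M)) by field; lra.
    by have := p4 e; lra.
  refine (filter_imp _ _ _ (filter_and _ _ Hd Hs)) => w [H1 H2].
  apply: Rle_lt_trans H1 _.
  have -> : (e : R) = 2 * (M * (e / (2 * M))) by field; lra.
  by apply: Rmult_lt_compat_l; [lra|apply: Rmult_lt_compat_l].
split; move=> P [e He]; apply: filter_imp (key e) => w hw; apply: He;
  apply: Rle_lt_trans hw; [exact: (Rabs_fst_le (F w - F z)%C)|].
exact: (Rabs_snd_le (F w - F z)%C).
Qed.

End Holomorphy.

(** * Iterated integrals on the whole slit plane *)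

Section IteratedHolomorphy.
Local Open Scope R_scope.

Let J := iterated_int.

Lemma segint_center (f : C -> C) : segint f center = RtoC 0.
Proof.
have H (p : C -> R) (g : R -> C) : p (RtoC 0) = 0 ->
    RInt (fun t => p (g t * (center - center))%C) 0 1 = 0.
  move=> p0; rewrite (RInt_ext _ (fun=> 0)).
    by rewrite RInt_const /scal /= /mult /=; ring.
  by move=> t _; rewrite -p0; congr p; ring.
by congr pair; apply: (H _ (fun t => f (ray center t))).
Qed.

(** For x the bound 8 |s| of [wseries_bound] absorbs 1/|s|; for y it is 2 for the form times 4 for
    the series. *)
Lemma omega_wseries_bound (l : letter) (w : word) (s : C) :
  h1 (l :: w) -> s <> RtoC 0 -> Cmod s <= / 2 ->
  Cmod (omega l s * wseries w s)%C <= 8.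
Proof.
move=> hw s0 s2; rewrite Cmod_mult.
have sp := Cmod_ge_0 s.
case: l hw => hw.
  have [l [w' ->]] := h1_x hw; rewrite omega_x Cmod_inv //.
  have sn : 0 < Cmod s by apply/Cmod_gt_0.
  have := wseries_bound l w' s2; set c := Cmod (wseries _ _) => hc.
  apply: (Rmult_le_reg_l (Cmod s)) => //.
  by rewrite -Rmult_assoc Rinv_r; lra.
rewrite omega_y Cmod_inv; last by apply: Cmod_lt1_neq; lra.
have a : / 2 <= Cmod (1 - s)%C.
  have := Cmod_triangle (1 - s)%C s.
  have -> : (1 - s + s)%C = RtoC 1 by ring.
  by rewrite Cmod_1; lra.
have b : / Cmod (1 - s)%C <= 2.
  by rewrite -(Rinv_inv 2); apply: Rinv_le_contravar => //; lra.
have c : 0 < / Cmod (1 - s)%C by apply: Rinv_0_lt_compat; lra.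
have d : Cmod (wseries w s) <= 4.
  case: (w) => [|l w']; first by rewrite wseries_nil Cmod_1; lra.
  by have := wseries_bound l w' s2; lra.
by have := Cmod_ge_0 (wseries w s); nra.
Qed.

(** Here [K] is a primitive of the integrand that agrees with the power series at 1/2. It then
    agrees with the series on ]0,1[, and its bounded derivative makes it close to 0 at every point
    of D near 0. Cutting the segment from 0 to z at e z and letting e tend to 0 identifies the
    integral with [K z]. *)
Section Step.
Variables (l : letter) (w : word) (K : C -> C).
Hypothesis hw : h1 (l :: w).
Let f (s : C) : C := (omega l s * J w s)%C.
Hypothesis cf : contD f.
Hypothesis dK : hder K f.
Hypothesis K_center : K center = wseries (l :: w) center.

Let fE (s : C) : Cmod s < 1 -> f s = (omega l s * wseries w s)%C.
Proof. by move=> s1; rewrite /f /J iterated_int_disk //; apply: h1_behead hw. Qed.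

(** K and the series have the same derivative along the ray from 0 to m; the parameter runs over
    [a/m, 1] to stay away from the singularity at 0. *)
Let K_real_sub (m a : R) : 0 < a <= m -> m < 1 ->
  (K (RtoC a) - wseries (l :: w) (RtoC a) = K (RtoC m) - wseries (l :: w) (RtoC m))%C.
Proof.
move=> am m1.
have mm : Cmod (RtoC m) < 1 by rewrite Cmod_R Rabs_pos_eq; lra.
have am1 : a / m <= 1 by apply/(Rdiv_le_1 a m); lra.
have am0 : 0 < a / m by apply: Rdiv_lt_0_compat; lra.
have := @cderiv0_const (fun t => K (RtoC 0 + RtoC t * RtoC m)%C
   + (- RtoC 1) * wseries (l :: w) (RtoC t * RtoC m))%C (a / m) 1 am1.
have -> : (RtoC (a / m) * RtoC m)%C = RtoC a.
  by rewrite -RtoC_mult; congr RtoC; field; lra.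
rewrite !Cplus_0_l Cmult_1_l => H.
have {}H : (K (RtoC a) + - RtoC 1 * wseries (l :: w) (RtoC a) =
            K (RtoC m) + - RtoC 1 * wseries (l :: w) (RtoC m))%C.
  apply: H => t ht.
  have tm : 0 < t * m < 1 by split; [apply: Rmult_lt_0_compat|]; nra.
  have st : slit (RtoC 0 + RtoC t * RtoC m)%C.
    by rewrite Cplus_0_l -RtoC_mult; apply: slit_real.
  have D1 := hder_at dK st.
  have D2 := cderiv_scal (- RtoC 1)%C (cderiv_wseries mm (l :: w) (t := t) ltac:(lra)).
  apply: cderiv_eq (cderiv_plus D1 D2) _.
  rewrite dwseriesE //; last lra.
  rewrite Cplus_0_l fE; first by ring.
  by rewrite -RtoC_mult Cmod_R Rabs_pos_eq; lra.
have -> : (K (RtoC a) - wseries (l :: w) (RtoC a) =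
           K (RtoC a) + - RtoC 1 * wseries (l :: w) (RtoC a))%C by ring.
by rewrite H; ring.
Qed.

Let K_real (r : R) : 0 < r < 1 -> K (RtoC r) = wseries (l :: w) (RtoC r).
Proof.
move=> r01.
have E : (K (RtoC r) - wseries (l :: w) (RtoC r) = RtoC 0)%C.
  have E0 : (K center - wseries (l :: w) center = RtoC 0)%C by rewrite K_center; ring.
  rewrite -E0 /center; case: (Rle_dec r (/ 2)) => hr.
    by apply: K_real_sub; lra.
  by apply/esym/K_real_sub; lra.
have -> : K (RtoC r) = (K (RtoC r) - wseries (l :: w) (RtoC r) + wseries (l :: w) (RtoC r))%C.
  by ring.
by rewrite E Cplus_0_l.
Qed.

(* K has a bounded derivative near 0. *)
Let K_near0 (z : C) (e : R) : slit z -> 0 < e -> e * Cmod z <= / 2 ->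
  Cmod (K (RtoC e * z) - wseries (l :: w) (RtoC (e * Cmod z)))%C <= 32 * (e * Cmod z).
Proof.
move=> sz e0 e2; have zn := slit_neq0 sz; have z0 : 0 < Cmod z by apply/Cmod_gt_0.
set r := e * Cmod z; have r0 : 0 < r by apply: Rmult_lt_0_compat.
rewrite -/r in e2; rewrite -K_real; last lra.
pose h := (RtoC e * z - RtoC r)%C.
have hb : Cmod h <= 2 * r.
  apply: Rle_trans (Cmod_triangle _ _) _.
  by rewrite Cmod_opp Cmod_scal ?Cmod_R ?(Rabs_pos_eq r) -/r; lra.
(* The point e z is joined to the positive real point r of the same modulus; the segment avoids both
   cuts and, by convexity, stays in the disc of radius 1/2. *)
have sp t : 0 <= t <= 1 -> slit (RtoC r + RtoC t * h)%C.
  move=> ht; rewrite /slit /h /=.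
  case: (Req_dec (snd z) 0) => [E|N].
    case: (sz) => [//|z01].
    have Er : r = e * fst z.
      rewrite /r; congr Rmult; rewrite [z]surjective_pairing E.
      by rewrite -[(fst z, 0)]/(RtoC (fst z)) Cmod_R Rabs_pos_eq //=; lra.
    by right; rewrite E Er; rewrite -Er; nra.
  case: (Req_dec t 0) => [->|t0].
    by right; nra.
  left; have -> : 0 + (t * (e * snd z + 0 * fst z + - 0) + 0 * (e * fst z - 0 * snd z + - r))
    = t * (e * snd z) by ring.
  by do 2?(apply: Rmult_integral_contrapositive; split) => //; lra.
have pb t : 0 <= t <= 1 -> Cmod (RtoC r + RtoC t * h)%C <= / 2.
  move=> ht; have -> : (RtoC r + RtoC t * h)%C = (RtoC (1 - t) * RtoC r + RtoC t * (RtoC e * z))%C.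
    by rewrite /h RtoC_minus; ring.
  apply: Rle_trans (Cmod_triangle _ _) _.
  rewrite !Cmod_scal ?Cmod_R ?(Rabs_pos_eq r) -/r; lra.
(* The derivative along the segment is at most 8 times |h| <= 2 r; the increment estimate doubles
   this to 32 r. *)
have := @cderiv_increment (fun t => K (RtoC r + RtoC t * h)%C)
   (fun t => f (RtoC r + RtoC t * h) * h)%C (16 * r).
have -> : (RtoC r + RtoC 1 * h)%C = (RtoC e * z)%C by rewrite /h; ring.
have -> : (RtoC r + RtoC 0 * h)%C = RtoC r by ring.
move=> H; have -> : 32 * r = 2 * (16 * r) by ring.
apply: H => t ht; first by apply: hder_at => //; apply: sp.
rewrite fE; last by have := pb t ht; lra.
rewrite Cmod_mult.
have := omega_wseries_bound hw (slit_neq0 (sp t ht)) (pb t ht).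
have := Cmod_ge_0 h; have := Cmod_ge_0 (omega l (RtoC r + RtoC t * h) * wseries w (RtoC r + RtoC t * h))%C.
by nra.
Qed.

(** On [0,e] the segment lies in the unit disc and the series is a primitive, with parameter t/e on
    the ray to e z; on [e,1] the primitive is K. *)
Let J_split (z : C) (e : R) : slit z -> 0 < e < 1 -> e * Cmod z <= / 2 ->
  J (l :: w) z = (wseries (l :: w) (RtoC e * z) + (K z - K (RtoC e * z)))%C.
Proof.
move=> sz e01 e2; rewrite /J iterated_int_cons; apply: segment_intE.
have z0 := Cmod_ge_0 z.
have ez1 : Cmod (RtoC e * z)%C < 1 by rewrite Cmod_scal; lra.
have st t : 0 < t <= 1 -> slit (RtoC 0 + RtoC t * z)%C.
  move=> ht; rewrite Cplus_0_l; case: sz => sz; [left|right] => /=.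
    by rewrite Rmult_0_l Rplus_0_r; apply: Rmult_integral_contrapositive; split; lra.
  by rewrite Rmult_0_l; nra.
apply: (is_CInt_Chasles (b := e)).
  have dg t : is_derive (fun s => s / e) t (/ e).
    by auto_derive => //; field; lra.
  have cg t : continuous (fun s => s / e) t.
    by apply: ex_derive_continuous; eexists; apply: dg.
  have te t : 0 <= t <= e -> 0 <= t / e <= 1.
    move=> ht; split; first by apply: Rdiv_le_0_compat; lra.
    by apply/(Rdiv_le_1 t e); lra.
  have := @is_CInt_derive (fun t => wseries (l :: w) (RtoC (t / e) * (RtoC e * z))%C)
    (fun t => RtoC (/ e) * dwseries (RtoC e * z) (l :: w) (t / e))%C 0 e ltac:(lra).
  have -> : e / e = 1 by field; lra.
  have -> : 0 / e = 0 by field; lra.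
  rewrite Cmult_1_l Cmult_0_l wseries0.
  have -> : (wseries (l :: w) (RtoC e * z) - RtoC 0 = wseries (l :: w) (RtoC e * z))%C by ring.
  move=> H; apply: (is_CInt_ext _ _ (H _ _)); first lra.
  - move=> t ht.
    have te0 : 0 < t / e by apply: Rdiv_lt_0_compat; lra.
    have tE : (RtoC (t / e) * (RtoC e * z))%C = (RtoC t * z)%C.
      by rewrite Cmult_assoc -RtoC_mult; congr (RtoC _ * _)%C; field; lra.
    rewrite dwseriesE //; last by split => //; apply: (te t _).2; lra.
    rewrite tE iterated_int_disk; first last.
    - rewrite Cmod_scal; last lra.
      by move: ez1; rewrite Cmod_scal; [nra|lra].
    - exact: h1_behead hw.
    have eE : (RtoC (/ e) * RtoC e)%C = RtoC 1.
      by rewrite -RtoC_mult; congr RtoC; field; lra.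
    set a := (omega _ _ * _)%C.
    have -> : (RtoC (/ e) * (a * (RtoC e * z)) = (RtoC (/ e) * RtoC e) * (a * z))%C by ring.
    by rewrite eE Cmult_1_l.
  - move=> t ht.
    exact: (cderiv_comp (f := fun s => wseries (l :: w) (RtoC s * (RtoC e * z))%C) (dg t)
              (cderiv_wseries ez1 (l :: w) (te t ht))).
  - move=> t ht; apply: cts_mult; first exact: cts_const.
    have [c1 c2] := cts_dwseries ez1 (l :: w) (te t ht).
    by split; [apply: (continuous_comp (fun s => s / e) (fun s => fst (dwseries _ _ s)))|
               apply: (continuous_comp (fun s => s / e) (fun s => snd (dwseries _ _ s)))].
have := @is_CInt_derive (fun t => K (RtoC 0 + RtoC t * z)%C)
   (fun t => f (RtoC 0 + RtoC t * z) * z)%C e 1 ltac:(lra).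
rewrite !Cplus_0_l Cmult_1_l => H.
apply: (is_CInt_ext _ _ (H _ _)); first lra.
- by move=> t ht; rewrite Cplus_0_l.
- by move=> t ht; apply: hder_at => //; apply: st; lra.
- move=> t ht; apply: cts_mult; last exact: cts_const.
  apply: (cts_comp (f := f)); first by apply: cf; apply: st; lra.
  exact: cts_affine.
Qed.

Lemma iterated_int_primitive (z : C) : slit z -> J (l :: w) z = K z.
Proof.
move=> sz; have zn := slit_neq0 sz; have z0 : 0 < Cmod z by apply/Cmod_gt_0.
pose D := (J (l :: w) z - K z)%C.
suff D0 : D = RtoC 0.
  have -> : J (l :: w) z = (D + K z)%C by rewrite /D; ring.
  by rewrite D0 Cplus_0_l.
(* 48 = 8 + 32 + 8: the series at e z, the deviation of K in [K_near0], and the series at the real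
   point e |z|. *)
have bound e : 0 < e < 1 -> e * Cmod z <= / 2 -> Cmod D <= 48 * (e * Cmod z).
  move=> e01 e2.
  have -> : D = (wseries (l :: w) (RtoC e * z) +
     (- (K (RtoC e * z) - wseries (l :: w) (RtoC (e * Cmod z)))
      + - wseries (l :: w) (RtoC (e * Cmod z))))%C.
    by rewrite /D (J_split sz e01 e2); ring.
  apply: Rle_trans (Cmod_triangle _ _) _.
  have := Cmod_triangle (- (K (RtoC e * z) - wseries (l :: w) (RtoC (e * Cmod z))))%C
     (- wseries (l :: w) (RtoC (e * Cmod z)))%C.
  rewrite !Cmod_opp.
  have := K_near0 sz (proj1 e01) e2.
  have Er : Cmod (RtoC (e * Cmod z)) = e * Cmod z.
    by rewrite Cmod_R Rabs_pos_eq //; nra.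
  have Ee : Cmod (RtoC e * z) = e * Cmod z by apply: Cmod_scal; lra.
  have := @wseries_bound l w (RtoC (e * Cmod z)); rewrite Er => /(_ e2).
  have := @wseries_bound l w (RtoC e * z)%C; rewrite Ee => /(_ e2).
  by lra.
apply: Cmod_eq_0; apply: Rle_antisym; last exact: Cmod_ge_0.
apply: Rnot_lt_le => Dp.
(* The first two bounds make [bound] applicable; the third turns it into |D| <= |D| / 2. *)
pose e := Rmin (/ 2) (Rmin (/ (2 * Cmod z)) (Cmod D / (96 * Cmod z))).
have e1 : 0 < e.
  do 2?apply: Rmin_pos; first lra.
    by apply: Rinv_0_lt_compat; lra.
  by apply: Rdiv_lt_0_compat; lra.
have l1 : e <= / 2 by apply: Rmin_l.
have l2 : e <= / (2 * Cmod z) by apply: Rle_trans (Rmin_r _ _) (Rmin_l _ _).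
have l3 : e <= Cmod D / (96 * Cmod z) by apply: Rle_trans (Rmin_r _ _) (Rmin_r _ _).
have m2 : e * Cmod z <= / 2.
  apply: Rle_trans (Rmult_le_compat_r _ _ _ (Rlt_le _ _ z0) l2) _.
  by right; field; lra.
have m3 : e * Cmod z <= Cmod D / 96.
  apply: Rle_trans (Rmult_le_compat_r _ _ _ (Rlt_le _ _ z0) l3) _.
  by right; field; lra.
have := bound e ltac:(lra) m2; lra.
Qed.

End Step.

Definition diterated (w : word) : C -> C :=
  if w is l :: w' then fun z => (omega l z * J w' z)%C else fun=> RtoC 0.

(** To integrate against the next form, [hder_segint] asks for an integrand that is continuous with
    a continuous derivative; hence all three properties are carried through the induction. *)
Lemma hder_iterated_aux (w : word) : h1 w ->
  [/\ hder (J w) (diterated w), contD (J w) & contD (diterated w)].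
Proof.
elim: w => [|l w IH] hw.
  by split; [apply: hder_const|move=> z sz; apply: cts_const..].
have [dJ cJ cdJ] := IH (h1_behead hw).
pose f (s : C) : C := (omega l s * J w s)%C.
pose df (s : C) : C := (domega l s * J w s + omega l s * diterated w s)%C.
have cf : contD f by apply: contD_mult => //; apply: contD_omega.
have dF : hder f df by apply: hder_mult => //; apply: hder_omega.
have cdf : contD df.
  apply: contD_plus; apply: contD_mult => //; first exact: contD_domega.
  exact: contD_omega.
pose K z := (segint f z + wseries (l :: w) center)%C.
have dK : hder K f.
  have := hder_plus (hder_segint cf cdf dF) (hder_const (wseries (l :: w) center)).
  by apply: hder_ext => // z _; ring.
have JK z : slit z -> K z = J (l :: w) z.
  move=> sz; apply/esym/iterated_int_primitive => //.
  by rewrite /K segint_center Cplus_0_l.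
have dJl : hder (J (l :: w)) f by apply: hder_ext dK.
by split => //; apply: hder_contD dJl cf.
Qed.

Lemma hder_iterated_int (l : letter) (w : word) : h1 (l :: w) ->
  hder (iterated_int (l :: w)) (fun z => (omega l z * iterated_int w z)%C).
Proof. by case/hder_iterated_aux. Qed.

End IteratedHolomorphy.

(** * Regularised polylogarithms *)

Section Logarithm.
Local Open Scope R_scope.

Lemma Cmod_sqr_gt0 (z : C) : z <> RtoC 0 -> 0 < fst z ^ 2 + snd z ^ 2.
Proof.
move=> z0; have /Cmod_gt_0 := z0; rewrite /Cmod => H.
by apply: sqrt_lt_0_alt; rewrite sqrt_0.
Qed.

Lemma Cmod_sqr (z : C) : Cmod z ^ 2 = fst z ^ 2 + snd z ^ 2.
Proof.
rewrite /Cmod -Rsqr_pow2 Rsqr_sqrt //.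
by apply: Rplus_le_le_0_compat; apply: pow2_ge_0.
Qed.

Lemma Carg_ge0 (z : C) : 0 <= snd z -> Carg z = acos (fst z / Cmod z).
Proof. by move=> h; rewrite /Carg; case: RleP. Qed.

Lemma Carg_lt0 (z : C) : snd z < 0 -> Carg z = - acos (fst z / Cmod z).
Proof.
move=> h; rewrite /Carg; case: RleP => // H; exfalso.
by move: H; change (0 <= snd z -> False); lra. Qed.

Lemma sqrt_ratio (z : C) : z <> RtoC 0 ->
  sqrt (1 - (fst z / Cmod z)²) = Rabs (snd z) / Cmod z.
Proof.
move=> z0; have mz : 0 < Cmod z by apply/Cmod_gt_0.
have E := Cmod_sqr z.
have -> : 1 - (fst z / Cmod z)² = (Rabs (snd z) / Cmod z)².
  rewrite /Rsqr.
  have -> : Rabs (snd z) / Cmod z * (Rabs (snd z) / Cmod z)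
    = Rabs (snd z) ^ 2 / Cmod z ^ 2 by field; lra.
  rewrite pow2_abs.
  have -> : snd z ^ 2 = Cmod z ^ 2 - fst z ^ 2 by rewrite E; ring.
  by field; lra.
by apply: sqrt_Rsqr; apply: Rdiv_le_0_compat => //; apply: Rabs_pos.
Qed.

(** The half planes Re > 0, Im > 0 and Im < 0 cover the slit plane. On each of them [Carg] is given
    by a single arctangent, which also removes the change of sign of the acos formula across the
    real axis. *)
Lemma Carg_right (z : C) : 0 < fst z -> Carg z = atan (snd z / fst z).
Proof.
move=> x0; have z0 : z <> RtoC 0 by move=> E; move: x0; rewrite E /=; lra.
have mz : 0 < Cmod z by apply/Cmod_gt_0.
have E : acos (fst z / Cmod z) = atan (Rabs (snd z) / fst z).
  rewrite acos_atan; last by apply: Rdiv_lt_0_compat.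
  by rewrite sqrt_ratio //; congr atan; field; lra.
case: (Rle_lt_dec 0 (snd z)) => hy; first by rewrite Carg_ge0 // E Rabs_pos_eq.
rewrite Carg_lt0 // E -atan_opp Rabs_left //; congr atan; field; lra.
Qed.

Lemma acos_ratio (z : C) : snd z <> 0 ->
  acos (fst z / Cmod z) = PI / 2 - atan (fst z / Rabs (snd z)).
Proof.
move=> y0; have z0 : z <> RtoC 0 by move=> E; move: y0; rewrite E.
have mz : 0 < Cmod z by apply/Cmod_gt_0.
have yp : 0 < Rabs (snd z) by apply: Rabs_pos_lt.
have E := Cmod_sqr z.
have y2 : 0 < snd z ^ 2 by rewrite -pow2_abs; apply: pow_lt.
have b : -1 < fst z / Cmod z < 1.
  have q : (fst z / Cmod z) * Cmod z = fst z by field; lra.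
  have xm : - Cmod z < fst z < Cmod z by split; nra.
  by split; apply: (Rmult_lt_reg_r (Cmod z)) => //; lra.
rewrite acos_asin; last lra.
rewrite asin_atan // sqrt_ratio //; congr (_ - atan _); field; lra.
Qed.

Lemma Carg_up (z : C) : 0 < snd z -> Carg z = PI / 2 - atan (fst z / snd z).
Proof.
by move=> y0; rewrite Carg_ge0 ?acos_ratio ?Rabs_pos_eq //; lra.
Qed.

Lemma Carg_down (z : C) : snd z < 0 -> Carg z = - (PI / 2) - atan (fst z / snd z).
Proof.
move=> y0; rewrite Carg_lt0 // acos_ratio; last lra.
have -> : fst z / Rabs (snd z) = - (fst z / snd z).
  by rewrite Rabs_left //; field; lra.
by rewrite atan_opp; ring.
Qed.

Lemma locally_affine_gt (x a c : R) : c < x -> locally 0 (fun s => c < x + s * a).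
Proof.
move=> cx; have H : continuous (fun s => x + s * a) 0.
  by apply: ex_derive_continuous; auto_derive.
by apply: H; rewrite Rmult_0_l Rplus_0_r; apply: open_gt.
Qed.

Lemma hder_Clog : hder Clog (omega lx).
Proof.
move=> z h sz; have zn := slit_neq0 sz; have p := Cmod_sqr_gt0 zn.
set x := fst z in p *; set y := snd z in p *; set a := fst h; set b := snd h.
have E s : (z + RtoC s * h)%C = (x + s * a, y + s * b).
  by rewrite [z]surjective_pairing [h]surjective_pairing; congr pair => /=;
    rewrite -/x -/y -/a -/b; ring.
have Eo : (omega lx z * h)%C = ((x * a + y * b) / (x ^ 2 + y ^ 2),
                               (x * b - y * a) / (x ^ 2 + y ^ 2)).
  rewrite omega_x [z]surjective_pairing [h]surjective_pairing -/x -/y -/a -/b.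
  by congr pair; rewrite /=; field; lra.
rewrite Eo; apply: (cderiv_ext (f := fun s => Clog (x + s * a, y + s * b))).
  by move=> s; rewrite E.
split; rewrite /Clog; cbn [fst snd].
  apply: (is_derive_ext (fun s => ln (sqrt ((x + s * a) ^ 2 + (y + s * b) ^ 2)))).
    by [].
  auto_derive.
    rewrite !Rmult_0_l !Rplus_0_r; split; first by [].
    by split => //; apply: sqrt_lt_R0.
  rewrite !Rmult_0_l !Rplus_0_r.
  have q : 0 < sqrt (x ^ 2 + y ^ 2) by apply: sqrt_lt_R0.
  have e : sqrt (x ^ 2 + y ^ 2) * sqrt (x ^ 2 + y ^ 2) = x ^ 2 + y ^ 2.
    by apply: sqrt_sqrt; lra.
  rewrite -[x * (x * 1)]/(x ^ 2) -[y * (y * 1)]/(y ^ 2).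
  set r := sqrt _ in q e *.
  by rewrite -e; field; lra.
have right_case : 0 < x ->
    is_derive (fun s => Carg (x + s * a, y + s * b)) 0 ((x * b - y * a) / (x ^ 2 + y ^ 2)).
  move=> x0; apply: (is_derive_ext_loc (fun s => atan ((y + s * b) / (x + s * a)))).
    apply: filter_imp (locally_affine_gt a x0) => s hs.
    by rewrite Carg_right.
  auto_derive; first by rewrite Rmult_0_l Rplus_0_r; lra.
  by rewrite !Rmult_0_l !Rplus_0_r; field; rewrite /=; split; nra.
case: (Rtotal_order y 0) => [y0|[y0|y0]].
- apply: (is_derive_ext_loc (fun s => - (PI / 2) - atan ((x + s * a) / (y + s * b)))).
    have y1 : 0 < - y by lra.
    apply: filter_imp (locally_affine_gt (- b) y1) => s hs.
    by rewrite Carg_down //=; lra.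
  auto_derive; first by rewrite Rmult_0_l Rplus_0_r; lra.
  by rewrite !Rmult_0_l !Rplus_0_r; field; rewrite /=; split; nra.
- by apply: right_case; case: sz; rewrite -/x -/y; lra.
- apply: (is_derive_ext_loc (fun s => PI / 2 - atan ((x + s * a) / (y + s * b)))).
    apply: filter_imp (locally_affine_gt b y0) => s hs.
    by rewrite Carg_up.
  auto_derive; first by rewrite Rmult_0_l Rplus_0_r; lra.
  by rewrite !Rmult_0_l !Rplus_0_r; field; rewrite /=; split; nra.
Qed.

Lemma Clog_real (t : R) : 0 < t -> Clog (RtoC t) = RtoC (ln t).
Proof.
move=> t0; rewrite /Clog Carg_right //= Cmod_R Rabs_pos_eq; last lra.
by rewrite /Rdiv Rmult_0_l atan_0.
Qed.

End Logarithm.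

(** Rewrites the algebraic-structure operations on C as the concrete complex ones, for which [ring]
    and [field] are declared. *)
Ltac to_Cops := repeat match goal with
  | |- context [@GRing.add ?T ?a ?b] => change (@GRing.add T a b) with (Cplus a b)
  | |- context [@GRing.mul ?T ?a ?b] => change (@GRing.mul T a b) with (Cmult a b)
  | |- context [@GRing.opp ?T ?a] => change (@GRing.opp T a) with (Copp a)
  | |- context [@GRing.inv ?T ?a] => change (@GRing.inv T a) with (Cinv a)
  | |- context [@GRing.one ?T] => change (@GRing.one T) with (RtoC (IZR 1))
  | |- context [@GRing.zero ?T] => change (@GRing.zero T) with (RtoC (IZR 0))
  end; try match goal with |- @eq _ ?a ?b => change (@eq C a b) end.

Lemma Cnat_neq0 (n : nat) : n.+1%:R <> RtoC R0 :> C.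
Proof. by move/eqP; apply/negP; exact: C_natr_neq0. Qed.

Lemma hder_sum I (r : seq I) (F f : I -> C -> C) :
  (forall i, hder (F i) (f i)) ->
  hder (fun z => \sum_(i <- r) F i z) (fun z => \sum_(i <- r) f i z).
Proof.
move=> Ff; elim: r => [|i r IH].
  by apply: hder_ext (hder_const (RtoC R0)) => z _; rewrite big_nil.
by apply: hder_ext (hder_plus (Ff i) IH) => z _; rewrite big_cons.
Qed.

Lemma hder_scal (c : C) (F f : C -> C) :
  hder F f -> hder (fun z => c * F z) (fun z => c * f z).
Proof.
move=> dF; apply: hder_ext (hder_mult (hder_const c) dF) => z _ //.
by to_Cops; ring.
Qed.

Lemma hder_minus (F G f g : C -> C) :
  hder F f -> hder G g -> hder (fun z => F z - G z) (fun z => f z - g z).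
Proof.
move=> dF dG; apply: hder_ext (hder_plus dF (hder_scal (-1) dG)) => z _;
  by to_Cops; ring.
Qed.

(** The divided power log^n / n!, which is Li(x^n; z). *)
Fixpoint logp (n : nat) (z : C) : C :=
  if n is m.+1 then n%:R^-1 * (logp m z * Clog z) else 1.

Lemma hder_logp (n : nat) : hder (logp n.+1) (fun z => omega lx z * logp n z).
Proof.
elim: n => [|n IH].
  have := hder_scal (1%:R^-1) (hder_mult (hder_const 1) hder_Clog).
  apply: hder_ext => z _ //.
  by rewrite /= invr1; to_Cops; ring.
have := hder_scal (n.+2%:R^-1) (hder_mult IH hder_Clog).
apply: hder_ext => z _ //.
have E : logp n z * Clog z = n.+1%:R * logp n.+1 z.
  by rewrite /= mulrA mulfV ?mul1r // C_natr_neq0.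
have nS : n.+2%:R = n.+1%:R + 1 :> C by rewrite mulrSr.
have nz := @Cnat_neq0 n.+1; move: E nz; rewrite nS.
to_Cops => E nz; rewrite -Cmult_assoc E; field.
exact: nz.
Qed.

(* Li(u y x^n; z) *)
Fixpoint Lam_tail (n : nat) (u : word) (z : C) : C :=
  if n is m.+1 then
    n%:R^-1 * (Lam_tail m u z * Clog z - \sum_(v <- shl u [:: lx]) Lam_tail m v z)
  else iterated_int (rcons u ly) z.

Lemma Lam_tailS (n : nat) (u : word) (z : C) :
  Lam_tail n.+1 u z =
  n.+1%:R^-1 * (Lam_tail n u z * Clog z - \sum_(v <- shl u [:: lx]) Lam_tail n v z).
Proof. by []. Qed.

(** Among the insertions of x into [l :: u], the one in front of [l] has derivative omega_x times
    the previous level, which cancels the term coming from the derivative of log. With empty [u] the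
    outermost letter is the y itself, and what remains is Li(x^n) = [logp n]. *)
Lemma hder_Lam_tail (n : nat) :
  (forall l u, hder (Lam_tail n (l :: u)) (fun z => omega l z * Lam_tail n u z)) /\
  hder (Lam_tail n [::]) (fun z => omega ly z * logp n z).
Proof.
elim: n => [|n [IHl IH0]].
  split=> [l u|]; last exact: (@hder_iterated_int ly [::] erefl).
  apply: (@hder_iterated_int l (rcons u ly)).
  by rewrite /h1 /= last_rcons.
split=> [l u|].
  pose G z := Lam_tail n (l :: u) z * Clog z -
     (\sum_(v <- shl u [:: lx]) Lam_tail n (l :: v) z + Lam_tail n [:: lx, l & u] z).
  have D := hder_scal n.+1%:R^-1 (hder_minus (hder_mult (IHl l u) hder_Clog)
    (hder_plus (hder_sum (shl u [:: lx]) (fun v => IHl l v)) (IHl lx (l :: u)))).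
  apply: hder_ext D => z _; rewrite Lam_tailS.
    by rewrite sum_shl_cons shl0r big_seq1.
  have alg (c o m g p ox s : C) :
    c * ((o * m * g + p * ox) - (o * s + ox * p)) = o * (c * (m * g - s)).
    by to_Cops; ring.
  by rewrite -mulr_sumr; exact: alg.
have D := hder_scal n.+1%:R^-1 (hder_minus (hder_mult IH0 hder_Clog) (IHl lx [::])).
apply: hder_ext D => z _.
  by rewrite Lam_tailS shl0l big_seq1.
have alg (c o m g p ox : C) :
  c * ((o * m * g + p * ox) - ox * p) = o * (c * (m * g)) by to_Cops; ring.
exact: alg.
Qed.

(** [(Some u, n)] stands for the word u y x^n, and [(None, n)] for x^n. *)
Fixpoint split_tail (w : word) : option word * nat :=
  if w is a :: w' then
    match split_tail w', a with
    | (Some u, n), _ => (Some (a :: u), n)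
    | (None, n), lx => (None, n.+1)
    | (None, n), ly => (Some [::], n)
    end
  else (None, 0%N).

Definition Lam (w : word) (z : C) : C :=
  match split_tail w with
  | (Some u, n) => Lam_tail n u z
  | (None, n) => logp n z
  end.

Lemma split_tail_nseq (n : nat) : split_tail (nseq n lx) = (None, n).
Proof. by elim: n => //= n ->. Qed.

Lemma split_tail_cat (n : nat) (u : word) :
  split_tail (u ++ ly :: nseq n lx) = (Some u, n).
Proof. by elim: u => [|a u IH] /=; rewrite ?split_tail_nseq ?IH. Qed.

Lemma Lam_nseq (n : nat) (z : C) : Lam (nseq n lx) z = logp n z.
Proof. by rewrite /Lam split_tail_nseq. Qed.

Lemma Lam_cat (n : nat) (u : word) (z : C) :
  Lam (u ++ ly :: nseq n lx) z = Lam_tail n u z.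
Proof. by rewrite /Lam split_tail_cat. Qed.

Lemma Lam_nil (z : C) : Lam [::] z = 1. Proof. by []. Qed.

Lemma Lam_rcons (u : word) (z : C) : Lam (rcons u ly) z = iterated_int (rcons u ly) z.
Proof. by rewrite -{1}cats1 (Lam_cat 0). Qed.

Lemma hder_Lam (l : letter) (w : word) :
  hder (Lam (l :: w)) (fun z => omega l z * Lam w z).
Proof.
case: (word_casesr w) => [->|[u [n ->]]]; last first.
  apply: hder_ext ((hder_Lam_tail n).1 l u) => z _.
    by rewrite -cat_cons Lam_cat.
  by rewrite Lam_cat.
case: l.
  apply: hder_ext (hder_logp (size w)) => z _; last by rewrite Lam_nseq.
  by rewrite -(Lam_nseq (size w).+1).
apply: hder_ext (hder_Lam_tail (size w)).2 => z _; last by rewrite Lam_nseq.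
by rewrite -(Lam_cat (size w) [::]).
Qed.

(** * Logarithmic growth classes *)

Section Growth.
Local Open Scope R_scope.

(** The base [1 - ln t] is at least 1 on ]0, 1/2], so exponents can be raised freely when two bounds
    are combined. *)
Definition moderate (F : R -> C) : Prop :=
  exists A N, 0 <= A /\ forall t, 0 < t <= / 2 -> Cmod (F t) <= A * (1 - ln t) ^ N.

Definition small (F : R -> C) : Prop :=
  exists A N, 0 <= A /\ forall t, 0 < t <= / 2 -> Cmod (F t) <= A * (t * (1 - ln t) ^ N).

Lemma one_minus_ln_ge1 (t : R) : 0 < t <= / 2 -> 1 <= 1 - ln t.
Proof. by move=> ht; have := ln_le t 1; rewrite ln_1; lra. Qed.

Lemma moderate_ext (F G : R -> C) :
  (forall t, 0 < t <= / 2 -> F t = G t) -> moderate F -> moderate G.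
Proof. by move=> FG [A [N [A0 H]]]; exists A, N; split=> // t ht; rewrite -FG //; apply: H. Qed.

Lemma small_ext (F G : R -> C) :
  (forall t, 0 < t <= / 2 -> F t = G t) -> small F -> small G.
Proof. by move=> FG [A [N [A0 H]]]; exists A, N; split=> // t ht; rewrite -FG //; apply: H. Qed.

Lemma moderate_const (c : C) : moderate (fun=> c).
Proof.
by exists (Cmod c), 0%N; split=> [|t _]; [apply: Cmod_ge_0|rewrite pow_O; lra].
Qed.

Lemma small_id : small RtoC.
Proof.
by exists 1, 0%N; split=> [|t ht]; [lra|rewrite pow_O Cmod_R Rabs_pos_eq; lra].
Qed.

Lemma moderate_Clog : moderate (fun t => Clog (RtoC t)).
Proof.
exists 1, 1%N; split; first lra.
move=> t ht; have := one_minus_ln_ge1 ht => h.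
by rewrite Clog_real ?Cmod_R ?pow_1 ?Rabs_left1; lra.
Qed.

Lemma small_moderate (F : R -> C) : small F -> moderate F.
Proof.
move=> [A [N [A0 H]]]; exists A, N; split=> // t ht.
apply: Rle_trans (H t ht) _; apply: Rmult_le_compat_l => //.
have : 0 <= (1 - ln t) ^ N by apply: pow_le; have := one_minus_ln_ge1 ht; lra.
by nra.
Qed.

Lemma moderate_plus (F G : R -> C) :
  moderate F -> moderate G -> moderate (fun t => (F t + G t)%C).
Proof.
move=> [A [N [A0 H]]] [B [M [B0 K]]]; exists (A + B), (N + M)%N; split; first lra.
move=> t ht; have l1 := one_minus_ln_ge1 ht.
apply: Rle_trans (Cmod_triangle _ _) _; have := H t ht; have := K t ht.
rewrite pow_add; have p1 := pow_R1_Rle _ N l1; have p2 := pow_R1_Rle _ M l1.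
set x := (1 - ln t) ^ N in p1 *; set y := (1 - ln t) ^ M in p2 *.
move=> h1 h2; have xy1 : x <= x * y by nra.
have xy2 : y <= x * y by nra.
by nra.
Qed.

Lemma moderate_mult (F G : R -> C) :
  moderate F -> moderate G -> moderate (fun t => (F t * G t)%C).
Proof.
move=> [A [N [A0 H]]] [B [M [B0 K]]]; exists (A * B), (N + M)%N; split; first nra.
move=> t ht; rewrite Cmod_mult pow_add.
have -> : A * B * ((1 - ln t) ^ N * (1 - ln t) ^ M) =
          (A * (1 - ln t) ^ N) * (B * (1 - ln t) ^ M) by ring.
by apply: Rmult_le_compat (H t ht) (K t ht); apply: Cmod_ge_0.
Qed.

Lemma small_plus (F G : R -> C) :
  small F -> small G -> small (fun t => (F t + G t)%C).
Proof.
move=> [A [N [A0 H]]] [B [M [B0 K]]]; exists (A + B), (N + M)%N; split; first lra.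
move=> t ht; have l1 := one_minus_ln_ge1 ht.
apply: Rle_trans (Cmod_triangle _ _) _; have := H t ht; have := K t ht.
rewrite pow_add; have p1 := pow_R1_Rle _ N l1; have p2 := pow_R1_Rle _ M l1.
set x := (1 - ln t) ^ N in p1 *; set y := (1 - ln t) ^ M in p2 *.
move=> h1 h2; have xy1 : t * x <= t * (x * y) by apply: Rmult_le_compat_l; nra.
have xy2 : t * y <= t * (x * y) by apply: Rmult_le_compat_l; nra.
by nra.
Qed.

Lemma small_mult (F G : R -> C) :
  small F -> moderate G -> small (fun t => (F t * G t)%C).
Proof.
move=> [A [N [A0 H]]] [B [M [B0 K]]]; exists (A * B), (N + M)%N; split; first nra.
move=> t ht; rewrite Cmod_mult pow_add.
have -> : A * B * (t * ((1 - ln t) ^ N * (1 - ln t) ^ M)) =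
          (A * (t * (1 - ln t) ^ N)) * (B * (1 - ln t) ^ M) by ring.
by apply: Rmult_le_compat (H t ht) (K t ht); apply: Cmod_ge_0.
Qed.

Lemma exp_pow_INR (x : R) (n : nat) : exp x ^ n = exp (INR n * x).
Proof.
elim: n => [|n IH]; first by rewrite Rmult_0_l exp_0.
by rewrite S_INR -tech_pow_Rmult IH -exp_plus; congr exp; ring.
Qed.

(** With t = exp (- u), the domination of (1 + u)^(N + 1) by the exponential gives k (1 + u) <= B
    for all u >= 1, with B independent of u. *)
Lemma nonpos_of_small (k A : R) (N : nat) : 0 <= A ->
  (forall t, 0 < t <= / 2 -> k <= A * (t * (1 - ln t) ^ N)) -> k <= 0.
Proof.
move=> A0 H; apply: Rnot_lt_le => k0.
pose n := INR N.+1; have n0 : 0 < n by apply/lt_0_INR/ltP.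
pose B := A * (exp 1 * n ^ N.+1).
have B0 : 0 <= B.
  apply: Rmult_le_pos => //; apply: Rmult_le_pos; first exact: Rlt_le (exp_pos _).
  by apply: pow_le; lra.
have key u : 1 <= u -> k * (1 + u) <= B.
  move=> u1; have e1 : 2 <= exp 1 by have := exp_ineq1 1; lra.
  have eu : exp 1 <= exp u by case: u1 => [/exp_increasing|<-]; lra.
  have ht : 0 < exp (- u) <= / 2.
    split; first exact: exp_pos.
    by rewrite exp_Ropp; apply: Rinv_le_contravar; lra.
  have := H _ ht; rewrite ln_exp => Hk.
  have E : exp (- u) = exp 1 * / exp (1 + u).
    by rewrite exp_plus exp_Ropp; field; split; apply: Rgt_not_eq; apply: exp_pos.
  (* The n-th power, n = N + 1, of x <= exp x at x = (1 + u) / n. *)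
  have P : ((1 + u) / n) ^ N.+1 <= exp (1 + u).
    have -> : exp (1 + u) = exp ((1 + u) / n) ^ N.+1.
      by rewrite exp_pow_INR; congr exp; rewrite -/n; field; lra.
    apply: pow_incr; split; first by apply: Rdiv_le_0_compat; lra.
    have q : 0 < (1 + u) / n by apply: Rdiv_lt_0_compat; lra.
    by have := exp_ineq1 _ (Rgt_not_eq _ _ q); lra.
  have w0 : 0 < exp (1 + u) := exp_pos _.
  have Q : (1 + u) ^ N.+1 <= n ^ N.+1 * exp (1 + u).
    have -> : (1 + u) ^ N.+1 = n ^ N.+1 * ((1 + u) / n) ^ N.+1.
      by rewrite -Rpow_mult_distr; congr (_ ^ _); field; lra.
    by apply: Rmult_le_compat_l => //; apply: pow_le; lra.
  have Q2 : (exp (- u) * (1 - - u) ^ N) * (1 + u) <= exp 1 * n ^ N.+1.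
    have -> : 1 - - u = 1 + u by ring.
    have -> : exp (- u) * (1 + u) ^ N * (1 + u) = exp 1 * ((1 + u) ^ N.+1 * / exp (1 + u)).
      by rewrite E -tech_pow_Rmult; ring.
    apply: Rmult_le_compat_l; first lra.
    apply: (Rmult_le_reg_r (exp (1 + u))) => //.
    by rewrite Rmult_assoc Rinv_l; lra.
  apply: (Rle_trans _ (A * (exp (- u) * (1 - - u) ^ N) * (1 + u))).
    by apply: Rmult_le_compat_r => //; lra.
  by rewrite Rmult_assoc; apply: Rmult_le_compat_l.
(* For k > 0 this value of u makes the left-hand side B + 2 k, which exceeds B. *)
have := key (B / k + 1).
have p : 0 <= B / k by apply: Rdiv_le_0_compat.
have -> : k * (1 + (B / k + 1)) = B + 2 * k by field; lra.
by lra.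
Qed.

Lemma small_const_eq0 (c : C) : small (fun=> c) -> c = RtoC 0.
Proof.
move=> [A [N [A0 H]]]; apply: Cmod_eq_0; apply: Rle_antisym; last exact: Cmod_ge_0.
exact: nonpos_of_small A0 H.
Qed.

End Growth.

Lemma small0 : small (fun=> 0).
Proof.
apply: small_ext (small_mult small_id (moderate_const 0)) => t _.
by to_Cops; ring.
Qed.

Lemma small_scal (c : C) (F : R -> C) : small F -> small (fun t => c * F t).
Proof.
move=> sF; apply: small_ext (small_mult sF (moderate_const c)) => t _.
by to_Cops; ring.
Qed.

Lemma small_minus (F G : R -> C) : small F -> small G -> small (fun t => F t - G t).
Proof.
move=> sF sG; apply: small_ext (small_plus sF (small_scal (-1) sG)) => t _.
by to_Cops; ring.
Qed.

Lemma small_sum (I : eqType) (r : seq I) (F : I -> R -> C) :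
  (forall i, i \in r -> small (F i)) -> small (fun t => \sum_(i <- r) F i t).
Proof.
elim: r => [|i r IH] Fs; first by apply: small_ext small0 => t _; rewrite big_nil.
have s1 := Fs i (mem_head _ _).
have s2 := IH (fun j hj => Fs j (mem_behead (s := i :: r) hj)).
by apply: small_ext (small_plus s1 s2) => t _; rewrite big_cons.
Qed.

(** * Growth of Lam at 0, and of logarithms at 1 *)

Section LamGrowth.
Local Open Scope R_scope.

Lemma small_iterated_int (u : word) :
  small (fun t => iterated_int (rcons u ly) (RtoC t)).
Proof.
exists 8, 0%N; split; first lra.
move=> t ht; have mt : Cmod (RtoC t) = t by rewrite Cmod_R Rabs_pos_eq; lra.
rewrite iterated_int_disk; [|by rewrite /h1 last_rcons|by rewrite mt; lra].
case E : (rcons u ly) => [|l w]; first by case: (u) E.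
by have := wseries_bound l w (z := RtoC t); rewrite mt pow_O; lra.
Qed.

(** - ln (1 - t) <= 1 / (1 - t) - 1, and this is at most 2 t for t <= 1/2. *)
Lemma small_Clog_1m : small (fun t => Clog (1 - RtoC t)%C).
Proof.
exists 2, 0%N; split; first lra.
move=> t ht; rewrite -RtoC_minus Clog_real; last lra.
rewrite Cmod_R pow_O Rabs_left1; last by have := ln_le (1 - t) 1; rewrite ln_1; lra.
have p : 0 < / (1 - t) by apply: Rinv_0_lt_compat; lra.
have := exp_ineq1_le (ln (/ (1 - t))); rewrite exp_ln // ln_Rinv; last lra.
have : / (1 - t) <= 1 + 2 * t.
  apply: (Rmult_le_reg_r (1 - t)); first lra.
  by rewrite Rinv_l; nra.
by lra.
Qed.

End LamGrowth.

Lemma small_Lam_tail (n : nat) (u : word) : small (fun t => Lam_tail n u (RtoC t)).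
Proof.
elim: n u => [|n IH] u; first exact: small_iterated_int.
apply: small_scal; apply: small_minus; first exact: small_mult (IH u) moderate_Clog.
by apply: small_sum => v _; apply: IH.
Qed.

Lemma moderate_logp (n : nat) : moderate (fun t => logp n (RtoC t)).
Proof.
elim: n => [|n IH]; first exact: moderate_const.
exact: moderate_mult (moderate_const _) (moderate_mult IH moderate_Clog).
Qed.

Lemma small_logp_1m (n : nat) : small (fun t => logp n.+1 (1 - RtoC t)).
Proof.
have H : moderate (fun t => logp n (1 - RtoC t)).
  elim: n => [|n IH]; first exact: moderate_const.
  apply: moderate_mult (moderate_const _) (moderate_mult IH _).
  exact: small_moderate small_Clog_1m.
apply: small_scal; apply: small_ext (small_mult small_Clog_1m H) => t _.
exact: Cmult_comm.
Qed.

Lemma moderate_Lam (w : word) : moderate (fun t => Lam w (RtoC t)).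
Proof.
case: (word_casesr w) => [->|[u [n ->]]].
  by apply: moderate_ext (moderate_logp _) => t _; rewrite Lam_nseq.
by apply: small_moderate; apply: small_ext (small_Lam_tail n u) => t _; rewrite Lam_cat.
Qed.

Lemma small_Lam (w : word) : ly \in w -> small (fun t => Lam w (RtoC t)).
Proof.
case: (word_casesr w) => [->|[u [n ->]] _].
  by rewrite mem_nseq andbF.
by apply: small_ext (small_Lam_tail n u) => t _; rewrite Lam_cat.
Qed.

Lemma small_Lam_1m (w : word) :
  ly \notin w -> w <> [::] -> small (fun t => Lam w (1 - RtoC t)).
Proof.
case: (word_casesr w) => [->|[u [n ->]]]; last by rewrite mem_cat in_cons eqxx orbT.
case: (size w) => [//|n] _ _.
by apply: small_ext (small_logp_1m n) => t _; rewrite Lam_nseq.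
Qed.

(** The occurrence of y decides at which end a shuffle vanishes; the size shows that shuffles of
    nonempty words are nonempty. *)
Lemma mem_shl (u v w : word) : w \in shl u v ->
  (ly \in w) = (ly \in u) || (ly \in v) /\ size w = (size u + size v)%N.
Proof.
elim: u v w => [|a u IHu] v w; first by rewrite shl0l inE => /eqP ->.
elim: v w => [|b v IHv] w.
  by rewrite shl0r inE => /eqP ->; rewrite orbF addn0.
rewrite [shl _ _]/= mem_cat => /orP[] /mapP [w' hw' ->] /=.
  by have [E ->] := IHu _ _ hw'; rewrite in_cons E in_cons orbA.
have [E ->] := IHv _ hw'; rewrite in_cons E [in RHS]orbC [in RHS]in_cons.
by rewrite -orbA [_ || (ly \in _ :: _)]orbC /= addnS.
Qed.

Lemma Lam_shl (u v : word) (z : C) : slit z ->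
  \sum_(w <- shl u v) Lam w z = Lam u z * Lam v z.
Proof.
elim: u v z => [|a u IHu] v z sz; first by rewrite shl0l big_seq1 Lam_nil mul1r.
elim: v z sz => [|b v IHv] z sz; first by rewrite shl0r big_seq1 Lam_nil mulr1.
pose G z := \sum_(w <- shl (a :: u) (b :: v)) Lam w z - Lam (a :: u) z * Lam (b :: v) z.
have dG : hder G (fun=> RtoC R0).
  have D := hder_minus (hder_plus
     (hder_sum (shl u (b :: v)) (fun w => hder_Lam a w))
     (hder_sum (shl (a :: u) v) (fun w => hder_Lam b w)))
     (hder_mult (hder_Lam a u) (hder_Lam b v)).
  apply: hder_ext D => s ss; first by rewrite /G sum_shl_cons.
  have alg (p q x y x' y' : C) :
    (p * (x * y') + q * (x' * y)) - (p * x * y' + x' * (q * y)) = RtoC R0.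
    by to_Cops; rewrite -[R0]/(IZR 0); ring.
  by rewrite -!mulr_sumr IHu // IHv //; exact: alg.
have Gc t : slit t -> G t = G z.
  by move=> st; rewrite (hder_const_eq dG st) (hder_const_eq dG sz).
suff G0 : G z = 0 by apply/eqP; rewrite -subr_eq0; apply/eqP.
apply: small_const_eq0.
(* If y occurs in one of the words it occurs in all their shuffles, and both sides of the identity
   tend to 0 at 0. *)
case hy : ((ly \in a :: u) || (ly \in b :: v)).
  apply: (small_ext (F := fun t => G (RtoC t))).
    by move=> t ht; apply: Gc; apply: slit_real; lra.
  apply: small_minus.
    apply: small_sum => w /mem_shl [E _].
    by apply: small_Lam; rewrite E.
  case/orP: hy => hy; first exact: small_mult (small_Lam hy) (moderate_Lam _).
  apply: small_ext (small_mult (small_Lam hy) (moderate_Lam (a :: u))) => t _.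
  exact: Cmult_comm.
(* Otherwise all words are positive powers of x, unbounded at 0; the constant is computed at 1,
   where log vanishes. *)
move/negbT: hy; rewrite negb_or => /andP[hu hv].
apply: (small_ext (F := fun t => G (1 - RtoC t))).
  by move=> t ht; apply: Gc; apply: slit_1m; apply: slit_real; lra.
apply: small_minus.
  apply: small_sum => w /mem_shl [E s].
  apply: small_Lam_1m; first by rewrite E negb_or hu.
  by move=> w0; rewrite w0 in s.
apply: small_mult; first exact: small_Lam_1m.
exact/small_moderate/small_Lam_1m.
Qed.

(** * The constant phi *)

Definition phi (w : word) (z : C) : C :=
  dsum (fun p s => Lam (tau_word p) (1 - z) * Lam s z) w.

Lemma omega_swap (l : letter) (z : C) : omega (swap_letter l) (1 - z) = omega l z.
Proof. by case: l => //=; rewrite opprB addrC subrK. Qed.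

Lemma hder_Lam_tau (l : letter) (w : word) :
  hder (fun z => Lam (tau_word (rcons w l)) (1 - z))
       (fun z => - (omega l z * Lam (tau_word w) (1 - z))).
Proof.
rewrite tau_word_rcons.
apply: hder_ext (hder_comp_1m (hder_Lam (swap_letter l) (tau_word w))) => z _ //.
by rewrite -(omega_swap l z).
Qed.

(** Moving one letter across the cut, the derivative of the right factor before the move cancels
    that of the left factor after it. Only the derivative [dA] of the fixed prefix survives, and it
    is 0 when the prefix is empty. *)
Lemma hder_dsum (q w : word) (dA : C -> C) :
  hder (fun z => Lam (tau_word q) (1 - z)) dA ->
  hder (fun z => dsum (fun p s => Lam (tau_word (q ++ p)) (1 - z) * Lam s z) w)
       (fun z => dA z * Lam w z).
Proof.
elim: w q dA => [|a w IH] q dA HA.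
  apply: hder_ext HA => z _; last by rewrite Lam_nil mulr1.
  by rewrite /= cats0 Lam_nil mulr1 addr0.
have := hder_plus (hder_mult HA (hder_Lam a w)) (IH _ _ (hder_Lam_tau a q)).
apply: hder_ext => z _.
  rewrite /= cats0; congr (_ + _); apply: eq_dsum => p s.
  by rewrite cat_rcons.
have alg (d l A o m : C) : (d * l + A * (o * m)) + - (o * A) * m = d * l.
  by to_Cops; ring.
exact: alg.
Qed.

Lemma phi_const (w : word) (z z' : C) : slit z -> slit z' -> phi w z = phi w z'.
Proof.
have D : hder (phi w) (fun=> RtoC R0).
  have H : hder (fun z => Lam (tau_word [::]) (1 - z)) (fun=> RtoC R0) := hder_const 1.
  by apply: hder_ext (@hder_dsum [::] w _ H) => z0 _ //; exact: mul0r.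
by move=> sz sz'; rewrite (hder_const_eq D sz) (hder_const_eq D sz').
Qed.

Lemma dsum_mulr (c : C) (f : word -> word -> C) (w : word) :
  dsum (fun p s => c * f p s) w = c * dsum f w.
Proof.
elim: w f => [|a w IH] f /=; first by rewrite !addr0.
by rewrite IH mulrDr.
Qed.

Lemma dsum_mull (c : C) (f : word -> word -> C) (w : word) :
  dsum (fun p s => f p s * c) w = dsum f w * c.
Proof.
by rewrite mulrC -dsum_mulr; apply: eq_dsum => p s; rewrite mulrC.
Qed.

Lemma phi_shl (u v : word) (z : C) : slit z ->
  \sum_(w <- shl u v) phi w z = phi u z * phi v z.
Proof.
move=> sz; rewrite sum_shl_dsum -dsum_mull; apply: eq_dsum => u1 u2.
rewrite -dsum_mulr; apply: eq_dsum => v1 v2.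
under eq_bigr do rewrite -mulr_sumr.
rewrite -mulr_suml (sum_shl_tau (fun w => Lam w (1 - z))) !Lam_shl //.
  by rewrite mulrACA.
exact: slit_1m.
Qed.

Lemma Lam_x (z : C) : Lam [:: lx] z = Clog z.
Proof. by rewrite (Lam_nseq 1) -[LHS]/(1%:R^-1 * (1 * Clog z)) invr1 !mul1r. Qed.

Lemma phi_letter (l : letter) (z : C) :
  phi [:: l] z = Lam [:: l] z + Lam [:: swap_letter l] (1 - z).
Proof.
rewrite -[LHS]/(Lam [::] (1 - z) * Lam [:: l] z +
  (Lam [:: swap_letter l] (1 - z) * Lam [::] z + 0)).
by rewrite !Lam_nil mul1r mulr1 addr0.
Qed.

Lemma C_subKr (z : C) : (1 - (1 - z))%C = z.
Proof. exact: (subKr (1 : C)). Qed.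

(** This is the identity log z + Li_1(1 - z) = 0; both terms are small at z = 1 - t. *)
Lemma phi_x (z : C) : slit z -> phi [:: lx] z = 0.
Proof.
move=> sz; apply: small_const_eq0.
apply: (small_ext (F := fun t => Clog (1 - RtoC t) + Lam [:: ly] (RtoC t))).
  move=> t ht; rewrite -(@phi_const _ (1 - RtoC t)) //.
    by rewrite phi_letter Lam_x C_subKr.
  by apply: slit_1m; apply: slit_real; lra.
exact: small_plus small_Clog_1m (small_Lam _).
Qed.

Lemma phi_y (z : C) : slit z -> phi [:: ly] z = 0.
Proof.
move=> sz; apply: small_const_eq0.
apply: (small_ext (F := fun t => Lam [:: ly] (RtoC t) + Clog (1 - RtoC t))).
  move=> t ht; rewrite -(@phi_const _ (RtoC t)) //; last by apply: slit_real; lra.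
  by rewrite phi_letter Lam_x.
exact: small_plus (small_Lam _) small_Clog_1m.
Qed.

Lemma small_dsum (F : word -> word -> R -> C) (w : word) :
  (forall p s, p ++ s = w -> small (F p s)) -> small (fun t => dsum (fun p s => F p s t) w).
Proof.
elim: w F => [|a w IH] F HF.
  by apply: small_plus (HF [::] [::] erefl) small0.
apply: small_plus (HF [::] (a :: w) erefl) _.
by apply: (IH (fun p s => F (a :: p) s)) => p s ps; apply: HF; rewrite /= ps.
Qed.

Lemma moderate_dsum (F : word -> word -> R -> C) (w : word) :
  (forall p s, p ++ s = w -> moderate (F p s)) ->
  moderate (fun t => dsum (fun p s => F p s t) w).
Proof.
elim: w F => [|a w IH] F HF.
  by apply: moderate_plus (HF [::] [::] erefl) (moderate_const _).
apply: moderate_plus (HF [::] (a :: w) erefl) _.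
by apply: (IH (fun p s => F (a :: p) s)) => p s ps; apply: HF; rewrite /= ps.
Qed.

(** The constancy of phi read as a formula for its term with empty prefix: behaviour at 1 is
    expressed by words at 0 and shorter words at 1. *)
Lemma Lam_1mE (a : letter) (w : word) (t : R) : slit (RtoC t) ->
  Lam (a :: w) (1 - RtoC t) = phi (a :: w) center -
    dsum (fun p s => Lam (tau_word (a :: p)) (RtoC t) * Lam s (1 - RtoC t)) w.
Proof.
move=> st; rewrite -(@phi_const _ (1 - RtoC t)) //; first last.
- by right; rewrite /center /=; lra.
- exact: slit_1m.
rewrite -[phi _ _]/(Lam [::] (1 - (1 - RtoC t)) * Lam (a :: w) (1 - RtoC t) +
  dsum (fun p s => Lam (tau_word (a :: p)) (1 - (1 - RtoC t)) * Lam s (1 - RtoC t)) w).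
by rewrite Lam_nil mul1r C_subKr addrK.
Qed.

(** Induction on the length through [Lam_1mE], whose suffixes [s] are strictly shorter than the
    word. *)
Lemma moderate_Lam_1m (w : word) : moderate (fun t => Lam w (1 - RtoC t)).
Proof.
have [n] := ubnP (size w); elim: n w => // n IH [|a w] sw; first exact: moderate_const.
pose D t := dsum (fun p s => Lam (tau_word (a :: p)) (RtoC t) * Lam s (1 - RtoC t)) w.
have mD : moderate D.
  apply: (moderate_dsum (F := fun p s t =>
     Lam (tau_word (a :: p)) (RtoC t) * Lam s (1 - RtoC t))) => p s ps.
  apply: moderate_mult; first exact: moderate_Lam.
  apply: IH; move: sw; rewrite -ps /= size_cat ltnS.
  by apply: leq_trans; rewrite ltnS leq_addl.
have := moderate_plus (moderate_const (phi (a :: w) center))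
                      (moderate_mult (moderate_const (-1)) mD).
apply: moderate_ext => t ht.
rewrite Lam_1mE -/(D t); first by to_Cops; ring.
by apply: slit_real; lra.
Qed.

(** tau sends the initial x of every nonempty prefix to a final y, so the first factor is small at 0
    and outweighs the moderate second factor. *)
Lemma small_phi_Lam_1m (w : word) :
  small (fun t => phi (lx :: w) center - Lam (lx :: w) (1 - RtoC t)).
Proof.
apply: (small_ext (F := fun t =>
   dsum (fun p s => Lam (tau_word (lx :: p)) (RtoC t) * Lam s (1 - RtoC t)) w)).
  move=> t ht; rewrite Lam_1mE ?subKr //.
  by apply: slit_real; lra.
apply: (small_dsum (F := fun p s t =>
   Lam (tau_word (lx :: p)) (RtoC t) * Lam s (1 - RtoC t))) => p s _.
apply: small_mult (moderate_Lam_1m s); apply: small_Lam.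
by rewrite tau_word_cons mem_rcons in_cons eqxx.
Qed.

Lemma index_of_wordK (w : word) : h1 w ->
  word_of_index (index_of_word w) = w /\ all (fun k => (0 < k)%N) (index_of_word w).
Proof.
elim: w => [//|[|] w IH] hw; have [E P] := IH (h1_behead hw); last first.
  by rewrite /= P /word_of_index /= -/(word_of_index _) E.
have [l [w' Ew]] := h1_x hw.
rewrite /=; case Ei : (index_of_word w) E P => [|k ks] E /=.
  by move: E; rewrite Ew.
move=> /andP[k0 P]; split=> //; rewrite -E /word_of_index /=.
by case: k k0 {Ei E}.
Qed.

(** * Coefficients and multiple harmonic sums *)

Section Harmonic.

Lemma natrR (n : nat) : n%:R = INR n :> R. Proof. by rewrite INRE. Qed.

(** The y of the block contributes one factor 1/(n + 1) and the sum of the coefficients up to n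
    inclusive, which is the strict inequality of the summation indices; each x contributes one more
    factor. *)
Lemma coef_word_of_index (k : nat) (ks : seq nat) (n : nat) : (0 < k)%N ->
  (forall N, sum_f_R0 (coef (word_of_index ks)) N = harmonic ks N.+1) ->
  coef (word_of_index (k :: ks)) n.+1 = n.+1%:R ^- k * harmonic ks n.+1.
Proof.
case: k => // k _ H.
have -> : word_of_index (k.+1 :: ks) = nseq k lx ++ ly :: word_of_index ks.
  by rewrite /word_of_index /= -/(word_of_index ks) cat_rcons.
elim: k => [|k IH].
  rewrite -[LHS]/(sum_f_R0 (coef (word_of_index ks)) n / INR n.+1).
  by rewrite H natrR expr1 mulrC.
rewrite -[LHS]/(coef (nseq k lx ++ ly :: word_of_index ks) n.+1 / INR n.+1).
by rewrite IH natrR [in RHS]exprSr invfM mulrAC.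
Qed.

Lemma coef_word_of_index0 (k : nat) (ks : seq nat) : (0 < k)%N ->
  coef (word_of_index (k :: ks)) 0 = R0.
Proof. by case: k => [//|[|k] _]. Qed.

Lemma sum_coef_word_of_index (ks : seq nat) (N : nat) : all (fun k => (0 < k)%N) ks ->
  sum_f_R0 (coef (word_of_index ks)) N = harmonic ks N.+1.
Proof.
elim: ks N => [|k ks IH] N.
  move=> _; elim: N => [//|N IHN]; rewrite tech5 IHN /=; ring.
move=> /= /andP[k0 P].
elim: N => [|N IHN].
  by rewrite [RHS]big_geq //; exact: (@coef_word_of_index0 k ks).
rewrite tech5 IHN (coef_word_of_index _ k0) /=; last by move=> M; apply: IH.
by rewrite [RHS]big_nat_recr.
Qed.

Lemma mzvE (w : word) : h1 (lx :: w) ->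
  mzv (index_of_word (lx :: w)) = Series (coef (lx :: w)).
Proof.
move=> hw; have [E P] := index_of_wordK hw.
case Ei : (index_of_word _) E P => [|k ks] E // /andP[k0 P].
rewrite -E /mzv (Series_incr_1_aux (coef _)); last by rewrite E.
apply: Series_ext => n; apply/esym/coef_word_of_index => // N.
exact: sum_coef_word_of_index.
Qed.

Lemma polylog_seriesE (ks : seq nat) (z : C) : all (fun k => (0 < k)%N) ks ->
  polylog_series ks z = wseries (word_of_index ks) z.
Proof.
case: ks => [_|k ks /andP[k0 P]]; first by rewrite wseries_nil.
have T n : z ^+ n.+1 * n.+1%:R ^- k * RtoC (harmonic ks n.+1) =
    (RtoC (coef (word_of_index (k :: ks)) n.+1) * (z ^+ n.+1)%R)%C.
  rewrite coef_word_of_index //; last by move=> N; apply: sum_coef_word_of_index.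
  have -> : (n.+1%:R : C) ^- k = RtoC (n.+1%:R ^- k).
    rewrite natrC natrR; elim: k {k0} => [|k IH]; first by rewrite !expr0 !invr1.
    rewrite !exprS !invfM IH RtoC_mult; congr (_ * _).
    by rewrite RtoC_inv //; apply: not_0_INR.
  by rewrite RtoC_mult; to_Cops; ring.
have c0 := coef_word_of_index0 ks k0.
rewrite /polylog_series /CSeries /wseries; congr pair.
  rewrite [RHS]Series_incr_1_aux; last by rewrite c0 Rmult_0_l.
  by apply: Series_ext => n; rewrite T; exact: fst_scal.
rewrite [RHS]Series_incr_1_aux; last by rewrite c0 Rmult_0_l.
by apply: Series_ext => n; rewrite T; exact: snd_scal.
Qed.

End Harmonic.

(** * The value of phi on words of h^0 *)

Section ZetaValue.
Local Open Scope R_scope.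
Variable w : word.
Hypothesis hw : h1 (lx :: w).
Let c := coef (lx :: w).
Let F := phi (lx :: w) center.
Let S (t : R) : R := Series (fun n => c n * (1 - t) ^ n).

Let wseries_real (r : R) :
  wseries (lx :: w) (RtoC r) = RtoC (Series (fun n => c n * r ^ n)).
Proof.
have E n : ((RtoC r) ^+ n)%R = RtoC (r ^ n).
  elim: n => [//|n IH]; by rewrite CpowS IH -RtoC_mult.
congr pair; first by apply: Series_ext => n; rewrite E.
apply: is_series_unique; apply: (is_lim_seq_ext (fun=> 0)) (is_lim_seq_const _).
elim=> [|n IH]; first by rewrite sum_O E -[eq]/(@eq R) /=; ring.
by rewrite sum_Sn -IH E /Hierarchy.plus -[eq]/(@eq R) /=; ring.
Qed.

Let Lam_real (t : R) : 0 < t <= / 2 ->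
  Lam (lx :: w) (1 - RtoC t)%C = RtoC (S t).
Proof.
move=> ht; rewrite -wseries_real.
have -> : (1 - RtoC t)%C = RtoC (1 - t) by rewrite RtoC_minus.
rewrite -iterated_int_disk //; last by rewrite Cmod_R Rabs_pos_eq; lra.
case/lastP: (lx :: w) hw => // u l; rewrite /h1 last_rcons => ->.
exact: Lam_rcons.
Qed.

Let bound : exists A N, 0 <= A /\ forall t, 0 < t <= / 2 ->
  Cmod (F - RtoC (S t))%C <= A * (t * (1 - ln t) ^ N).
Proof.
have [A [N [A0 H]]] := small_phi_Lam_1m w; exists A, N; split=> // t ht.
by rewrite -(Lam_real ht); apply: H.
Qed.

Let ex_c (r : R) : 0 < r < 1 -> ex_series (fun n => c n * r ^ n).
Proof.
move=> hr; apply: (ex_series_le (V := R_CompleteNormedModule) _ (fun n => r ^ n)).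
  move=> n; have [c0 c1] := coef_ge0_le1 (lx :: w) n.
  have p : 0 <= r ^ n by apply: pow_le; lra.
  by rewrite /norm /= /abs /= Rabs_pos_eq; rewrite -/(c n) in c0 c1 *; nra.
by eexists; apply: is_series_geom; rewrite Rabs_pos_eq; lra.
Qed.

(** A partial sum at 1 exceeds the one at 1 - t by O(t), and the latter is at most S(t) by
    positivity; S(t) in turn differs from F by a small term. *)
Let partial_le (M : nat) : sum_f_R0 c M <= fst F.
Proof.
have [A [N [A0 H]]] := bound.
suff : sum_f_R0 c M - fst F <= 0 by lra.
(* There are M + 1 terms, and by the Bernoulli inequality each changes by at most n t <= (M + 1)
   t. *)
pose K := INR M.+1 * INR M.+1.
have K0 : 0 <= K by apply: Rmult_le_pos; apply: pos_INR.
apply: (@nonpos_of_small _ (A + K) N); first lra.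
move=> t ht; have ht1 : 0 <= 1 - t <= 1 by lra.
have Bern n : 1 - INR n * t <= (1 - t) ^ n.
  elim: n => [|n IH]; first by rewrite /=; lra.
  by rewrite S_INR -tech_pow_Rmult; have := pos_INR n; nra.
have P1 : sum_f_R0 c M - sum_f_R0 (fun n => c n * (1 - t) ^ n) M <= K * t.
  rewrite -minus_sum /K.
  apply: (Rle_trans _ (sum_f_R0 (fun=> INR M.+1 * t) M)).
    apply: sum_Rle => n /leP nM.
    have [c0 c1] := coef_ge0_le1 (lx :: w) n; rewrite -/(c n) in c0 c1.
    have nM' : INR n <= INR M.+1 by apply: le_INR; apply/leP; apply: leqW.
    have := Bern n; have := pos_INR n; have p1 : (1 - t) ^ n <= 1.
      by apply: (Rle_trans _ (1 ^ n)); [apply: pow_incr; lra|rewrite pow1; lra].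
    move=> n0 B; apply: (Rle_trans _ (1 - (1 - t) ^ n)); first by nra.
    apply: (Rle_trans _ (INR n * t)); first lra.
    by apply: Rmult_le_compat_r; lra.
  by rewrite sum_cte; right; ring.
have P2 : sum_f_R0 (fun n => c n * (1 - t) ^ n) M <= S t.
  rewrite -sum_n_Reals.
  apply: (is_lim_seq_incr_compare (sum_n (fun n => c n * (1 - t) ^ n))).
    by apply: Series_correct; apply: ex_c; lra.
  move=> n; rewrite sum_Sn /Hierarchy.plus /=.
  have [c0 _] := coef_ge0_le1 (lx :: w) n.+1; rewrite -/(c n.+1) in c0.
  have p : 0 <= (1 - t) ^ n.+1 by apply: pow_le; lra.
  by have := Rmult_le_pos _ _ c0 p; rewrite /=; lra.
have P3 := H t ht; have P4 := Rabs_fst_le (F - RtoC (S t))%C.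
have P5 : S t - fst F <= A * (t * (1 - ln t) ^ N).
  apply: Rle_trans P3; apply: Rle_trans P4.
  by rewrite -Rabs_Ropp /=; apply: Rle_trans (Rle_abs _); right; rewrite /=; ring.
have l1 := pow_R1_Rle _ N (one_minus_ln_ge1 ht).
have P6 : K * t <= K * (t * (1 - ln t) ^ N).
  by apply: Rmult_le_compat_l => //; nra.
by nra.
Qed.

(** Positivity of the coefficients gives an Abel limit with unknown convergence: bounded partial
    sums make the series converge with sum at most F, and S(t) is at most that sum. *)
Lemma phi_zeta : F = RtoC (mzv (index_of_word (lx :: w))).
Proof.
have [A [N [A0 H]]] := bound.
have c_ge0 n : 0 <= c n := (coef_ge0_le1 (lx :: w) n).1.
(* S(t) is real, so the imaginary part of F is bounded by |F - S(t)|. *)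
have F2 : snd F = 0.
  have : Cmod (RtoC (snd F)) <= 0.
    apply: (nonpos_of_small A0 (N := N)) => t /H; apply: Rle_trans.
    rewrite Cmod_R; apply: Rle_trans (Rabs_snd_le _).
    by right; congr Rabs; rewrite /=; ring.
  rewrite Cmod_R => ?; have := Rabs_pos (snd F) => ?.
  by apply: Rabs_eq_0; lra.
have [l Hl] : ex_series c.
  have [l hl] : ex_finite_lim_seq (sum_n c).
    apply: (ex_finite_lim_seq_incr _ (fst F)).
      move=> n; rewrite sum_Sn /Hierarchy.plus /=; have := c_ge0 n.+1; lra.
    by move=> n; rewrite sum_n_Reals; apply: partial_le.
  by exists l.
have lF : l <= fst F.
  apply: (is_lim_seq_le (sum_n c) (fun=> fst F) l (fst F)) => //.
    by move=> n; rewrite sum_n_Reals; apply: partial_le.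
  exact: is_lim_seq_const.
have Fl : fst F - l <= 0.
  apply: (nonpos_of_small A0 (N := N)) => t ht; apply: Rle_trans (H t ht).
  apply: Rle_trans (Rabs_fst_le _); apply: Rle_trans (Rle_abs _) => /=.
  have : S t <= Series c.
    apply: Series_le; last by exists l.
    move=> n; have := c_ge0 n; have p0 : 0 <= (1 - t) ^ n by apply: pow_le; lra.
    have p1 : (1 - t) ^ n <= 1 by apply: (Rle_trans _ (1 ^ n)); [apply: pow_incr; lra|rewrite pow1; lra].
    by split; nra.
  by rewrite (is_series_unique _ _ Hl); lra.
rewrite mzvE // -/c (is_series_unique _ _ Hl) [F]surjective_pairing F2.
by congr pair; lra.
Qed.

End ZetaValue.

(** * Regularisation *)

Definition Lam_lin (z : C) : ncpoly -> C := lin_ext (V := C^o) (Lam^~ z).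

Lemma Lam_word_of_index (ks : seq nat) (z : C) : all (fun k => (0 < k)%N) ks ->
  Lam (word_of_index ks) z = Li_h1 ks z.
Proof.
move=> P; have hK : h1 (word_of_index ks).
  rewrite /h1; elim/last_ind: ks {P} => [//|ks k _].
  by rewrite /word_of_index map_rcons flatten_rcons last_cat last_rcons.
have -> : Lam (word_of_index ks) z = iterated_int (word_of_index ks) z.
  case/lastP: (word_of_index ks) hK => // u l.
  by rewrite /h1 last_rcons => ->; apply: Lam_rcons.
rewrite /Li_h1; case: ifP => [/RltP z1|//].
by rewrite polylog_seriesE // iterated_int_disk.
Qed.

Lemma is_Li_Lam (z : C) : slit z -> is_Li z (Lam_lin z).
Proof.
move=> sz; split.
- by move=> c a b; exact: (@lin_extP C^o (Lam^~ z) c a b).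
- by apply: lin_ext_shuffle => u v; apply: Lam_shl.
- by rewrite /Lam_lin lin_ext_mon Lam_x.
- by move=> ks P; rewrite /Lam_lin lin_ext_mon Lam_word_of_index.
Qed.

(** The values are prescribed on h^1 and on x, and [h1_word_ind] propagates the agreement with Lam
    to all words. *)
Lemma is_Li_unique (z : C) (L : ncpoly -> C) (w : word) :
  slit z -> is_Li z L -> L (mon w) = Lam w z.
Proof.
move=> sz [Llin Lsh Lx Lks].
have [Mlin Msh Mx Mks] := is_Li_Lam sz.
suff : L (mon w) = Lam_lin z (mon w) by rewrite /Lam_lin lin_ext_mon.
have zero (M : ncpoly -> C) :
    (forall (c : C) (a b : ncpoly), M (c *: a + b) = c * M a + M b) -> M 0 = 0.
  by move=> HM; have := HM (-1) 0 0; rewrite scaler0 addr0 mulN1r addNr.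
move: w; apply: (h1_word_ind (Q := fun a => L a = Lam_lin z a)).
- by rewrite zero // zero.
- by move=> c a b Ea Eb; rewrite Llin Mlin Ea Eb.
- by move=> a Ea; rewrite Lsh Msh Ea Lx Mx.
- by rewrite (Lks [::]) // (Mks [::]).
- move=> u; have hu : h1 (rcons u ly) by rewrite /h1 last_rcons.
  have [E P] := index_of_wordK hu.
  by rewrite -E (Lks _ P) (Mks _ P).
Qed.

Lemma Li_mon (w : word) (z : C) : slit z -> Li (mon w) z = Lam w z.
Proof.
move=> sz; apply: is_Li_unique => //; rewrite /Li.
by apply: epsilon_spec; exists (Lam_lin z); apply: is_Li_Lam.
Qed.

Lemma tau_mon (w : word) : tau (mon w) = mon (tau_word w).
Proof. exact: lin_ext_mon. Qed.

Definition xy_power (i j : nat) : ncpoly :=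
  shuffle (shuffle_exp (mon [:: lx]) i) (shuffle_exp (mon [:: ly]) j).

Lemma xy_powerSl (i j : nat) : xy_power i.+1 j = shuffle (mon [:: lx]) (xy_power i j).
Proof. exact: (shuffleA (mon [:: lx]) (shuffle_exp (mon [:: lx]) i)). Qed.

Lemma xy_powerSr (i j : nat) : xy_power i j.+1 = shuffle (mon [:: ly]) (xy_power i j).
Proof.
pose X := shuffle_exp (mon [:: lx]) i; pose Y := shuffle_exp (mon [:: ly]) j.
transitivity (shuffle (shuffle X (mon [:: ly])) Y).
  exact: (esym (shuffleA X (mon [:: ly]) Y)).
by rewrite (shuffleC X (mon [:: ly])) (shuffleA (mon [:: ly]) X Y).
Qed.

(** A monomial of a shuffle polynomial, encoded by its two exponents and its coefficient. *)
Definition reg_term (t : nat * nat * ncpoly) : ncpoly :=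
  shuffle t.2 (xy_power t.1.1 t.1.2).

Lemma reg_term_x (t : nat * nat * ncpoly) :
  shuffle (reg_term t) (mon [:: lx]) = reg_term (t.1.1.+1, t.1.2, t.2).
Proof.
rewrite /reg_term /= xy_powerSl (shuffleA t.2 (xy_power t.1.1 t.1.2) (mon [:: lx])).
by rewrite (shuffleC (xy_power t.1.1 t.1.2) (mon [:: lx])).
Qed.

Lemma reg_term_y (t : nat * nat * ncpoly) :
  shuffle (reg_term t) (mon [:: ly]) = reg_term (t.1.1, t.1.2.+1, t.2).
Proof.
rewrite /reg_term /= xy_powerSr (shuffleA t.2 (xy_power t.1.1 t.1.2) (mon [:: ly])).
by rewrite (shuffleC (xy_power t.1.1 t.1.2) (mon [:: ly])).
Qed.

Lemma ncpoly_scalerAr (c : C) (a b : ncpoly) : a * (c *: b) = c *: (a * b).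
Proof.
apply/malgP => k; transitivity (c * (a * b)@_k); last exact: (esym (mcoeffZ c (a * b) k)).
apply: etrans (mcoeffMlw k (fsubset_refl (msupp a)) (msuppZ_le c b)) _.
rewrite (mcoeffMl a b k).
rewrite mulr_sumr.
apply: eq_bigr => i _; rewrite mulr_sumr; apply: eq_bigr => j _.
by rewrite mcoeffZ mulrCA mulrnAr.
Qed.

(* The library only makes monoid algebras left algebras, hence the explicit
   hypothesis that scalars are central. *)
Section CentralScalars.
Variable A : lalgType C.
Hypothesis scalerAr' : forall (c : C) (a b : A), a * (c *: b) = c *: (a * b).

Lemma sandwich_lin (x y p q : A) (k : C) :
  x * (k *: p + q) * y = k *: (x * p * y) + x * q * y.
Proof. by rewrite mulrDr mulrDl scalerAr' -scalerAl. Qed.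

Lemma sandwich_affine (c k l : C) (x y p q : A) :
  c *: (k *: 1 + x * p * y) + (l *: 1 + x * q * y) =
  (c * k + l) *: 1 + x * (c *: p + q) * y.
Proof. by rewrite sandwich_lin scalerDr scalerA addrACA -scalerDl. Qed.

Lemma sandwich0 (x y : A) (c : C) : c *: 1 = c *: 1 + x * 0 * y.
Proof. by rewrite mulr0 mul0r addr0. Qed.

End CentralScalars.

Lemma in_h0_lin (c : C) (a b : ncpoly) : in_h0 a -> in_h0 b -> in_h0 (c *: a + b).
Proof.
move=> [k [p ->]] [l [q ->]]; exists (c * k + l), (c *: p + q).
exact: (sandwich_affine ncpoly_scalerAr).
Qed.

Lemma in_h0_0 : in_h0 0.
Proof. by exists 0, 0; rewrite -[LHS](scale0r (1 : ncpoly)); apply: sandwich0. Qed.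

Lemma in_h0_nil : in_h0 (mon [::]).
Proof. by exists 1, 0; rewrite mon_nil -[LHS](scale1r (1 : ncpoly)); apply: sandwich0. Qed.

Lemma in_h0_word (u : word) : in_h0 (mon (lx :: rcons u ly)).
Proof.
exists 0, (mon u); rewrite (mon_cat [:: lx] u) (mon_cat (lx :: u) [:: ly]) cats1.
by rewrite scale0r add0r.
Qed.

(** A list of monomials, with repeated exponents allowed, is easily closed under linear combinations
    and under shuffling with a letter; [is_reg_ex] collects like terms into the form of [is_reg]. *)
Definition reg_decomposable (a : ncpoly) : Prop :=
  exists s : seq (nat * nat * ncpoly),
    (forall t, t \in s -> in_h0 t.2) /\ a = \sum_(t <- s) reg_term t.

Lemma reg_decomposable_lin (c : C) (a b : ncpoly) :
  reg_decomposable a -> reg_decomposable b -> reg_decomposable (c *: a + b).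
Proof.
move=> [r [rh ->]] [s [sh ->]].
exists ([seq (t.1, c *: t.2) | t <- r] ++ s); split.
  move=> t; rewrite mem_cat => /orP[/mapP [t' /rh ht' ->] | /sh //].
  have := in_h0_lin c ht' in_h0_0.
  by rewrite addr0.
rewrite big_cat big_map scaler_sumr; congr (_ + _); apply: eq_bigr => t _.
exact: (esym (shuffleZl c t.2 (xy_power t.1.1 t.1.2))).
Qed.

Lemma reg_decomposable_h0 (a : ncpoly) : in_h0 a -> reg_decomposable a.
Proof.
move=> ha; exists [:: (0%N, 0%N, a)]; split; first by move=> t; rewrite inE => /eqP ->.
rewrite big_seq1; transitivity (shuffle 1 a); first by rewrite (shuffle1l a).
have -> : shuffle 1 a = shuffle a 1 by exact: shuffleC.
by rewrite /reg_term /xy_power /= (shuffle1l 1).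
Qed.

Lemma reg_decomposable_x (a : ncpoly) :
  reg_decomposable a -> reg_decomposable (shuffle a (mon [:: lx])).
Proof.
move=> [s [sh ->]]; exists [seq (t.1.1.+1, t.1.2, t.2) | t <- s]; split.
  by move=> t /mapP [t' /sh ht' ->].
rewrite (shuffle_suml s reg_term) big_map; apply: eq_bigr => t _; exact: reg_term_x.
Qed.

Lemma reg_decomposable_y (a : ncpoly) :
  reg_decomposable a -> reg_decomposable (shuffle a (mon [:: ly])).
Proof.
move=> [s [sh ->]]; exists [seq (t.1.1, t.1.2.+1, t.2) | t <- s]; split.
  by move=> t /mapP [t' /sh ht' ->].
rewrite (shuffle_suml s reg_term) big_map; apply: eq_bigr => t _; exact: reg_term_y.
Qed.

(** The two stages h = h^1[x] and h^1 = h^0[y] of the decomposition, in turn. *)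
Lemma reg_decomposable_word (w : word) : reg_decomposable (mon w).
Proof.
have Q0 := reg_decomposable_h0 in_h0_0.
have Q1 := reg_decomposable_h0 in_h0_nil.
apply: (h1_word_ind Q0 reg_decomposable_lin reg_decomposable_x Q1).
apply: (h0_word_ind Q0 reg_decomposable_lin reg_decomposable_y Q1) => u.
exact/reg_decomposable_h0/in_h0_word.
Qed.

Lemma is_reg_ex (a : ncpoly) : reg_decomposable a -> exists c, is_reg a c.
Proof.
move=> [s [sh ->]].
(* A common bound for the exponents, so that each monomial falls on exactly one pair (i, j) of the
   square. *)
pose n := \max_(t <- s) maxn t.1.1 t.1.2.
pose p i j : ncpoly := \sum_(t <- s | (t.1.1 == i) && (t.1.2 == j)) t.2.
exists (p 0%N 0%N), n, p; split => //.
  move=> i j; rewrite /p; elim: s sh {n p} => [|t s IH] sh.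
    by rewrite big_nil; apply: in_h0_0.
  rewrite big_cons; have hs : in_h0 (\sum_(t <- s | (t.1.1 == i) && (t.1.2 == j)) t.2).
    by apply: IH => t' ht'; apply: sh; rewrite in_cons ht' orbT.
  case: ifP => // _; rewrite -[t.2]scale1r.
  by apply: in_h0_lin => //; apply: sh; rewrite mem_head.
have E i j : shuffle (p i j) (xy_power i j) =
    \sum_(t <- s) if (i == t.1.1) && (j == t.1.2) then reg_term t else 0.
  rewrite /p big_mkcond shuffle_suml; apply: eq_bigr => t _.
  rewrite ![i == _]eq_sym ![j == _]eq_sym.
  case: ifP => [/andP[/eqP <- /eqP <-] //|_]; exact: shuffle0l.
symmetry.
transitivity (\sum_(i < n.+1) \sum_(j < n.+1) \sum_(t <- s)
    if (val i == t.1.1) && (val j == t.1.2) then reg_term t else 0).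
  by apply: eq_bigr => i _; apply: eq_bigr => j _; apply: E.
under eq_bigr do rewrite exchange_big.
rewrite exchange_big /=; apply: eq_big_seq => t ts.
have := @leq_bigmax_seq _ s xpredT (fun t => maxn t.1.1 t.1.2) t ts isT.
rewrite -/n geq_max => /andP[ti tj].
have pick (F : nat -> nat -> ncpoly) (m : nat) : (m < n.+1)%N ->
    \sum_(i < n.+1) (if val i == m then F i m else 0) = F m m.
  move=> mn; rewrite -big_mkcond (big_pred1 (Ordinal mn)) //.
transitivity (\sum_(i < n.+1) if val i == t.1.1 then reg_term t else 0).
  apply: eq_bigr => i _; case: (val i == _) => /=; last by rewrite big1.
  exact: (pick (fun _ _ => reg_term t) _ (tj : t.1.2 < n.+1)%N).
exact: (pick (fun _ _ => reg_term t) _ (ti : t.1.1 < n.+1)%N).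
Qed.

(** * Evaluation of phi on a regularised decomposition *)

Definition phi_lin (z : C) : ncpoly -> C := lin_ext (V := C^o) (phi^~ z).

Lemma phi_lin_mon (w : word) (z : C) : phi_lin z (mon w) = phi w z.
Proof. exact: (@lin_ext_mon C^o). Qed.

Lemma phi_lin_shuffle (z : C) (a b : ncpoly) : slit z ->
  phi_lin z (shuffle a b) = phi_lin z a * phi_lin z b.
Proof. by move=> sz; apply: lin_ext_shuffle => u v; apply: phi_shl. Qed.

Lemma phi_nil (z : C) : phi [::] z = 1.
Proof. by rewrite -[LHS]/(1 * 1 + 0) mulr1 addr0. Qed.

Lemma phi_lin_shuffle_exp (l : letter) (n : nat) (z : C) : slit z ->
  phi_lin z (shuffle_exp (mon [:: l]) n) = (n == 0%N)%:R.
Proof.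
move=> sz; case: n => [|n].
  by rewrite -[shuffle_exp _ _]/(1 : ncpoly) -mon_nil phi_lin_mon phi_nil.
rewrite -[shuffle_exp _ _]/(shuffle (mon [:: l]) (shuffle_exp (mon [:: l]) n)).
rewrite phi_lin_shuffle // phi_lin_mon.
by case: l => /=; rewrite (phi_x, phi_y) // mul0r.
Qed.

Lemma phi_lin_h0 (a : ncpoly) (z : C) : slit z -> in_h0 a -> phi_lin z a = zeta_hat a.
Proof.
move=> sz [c [b ->]].
have Plin (k : C) p q : phi_lin z (k *: p + q) = k * phi_lin z p + phi_lin z q.
  exact: (@lin_extP C^o).
have Zlin (k : C) p q : zeta_hat (k *: p + q) = k * zeta_hat p + zeta_hat q.
  exact: (@lin_extP C^o).
have Zmon w : zeta_hat (mon w) = RtoC (mzv (index_of_word w)) by exact: (@lin_ext_mon C^o).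
rewrite Plin Zlin -mon_nil phi_lin_mon phi_nil Zmon.
suff -> : phi_lin z (mon [:: lx] * b * mon [:: ly]) = zeta_hat (mon [:: lx] * b * mon [:: ly]).
  by [].
move: b; refine (@lin_map_ext C^o (fun b => phi_lin z (mon [:: lx] * b * mon [:: ly]))
   (fun b => zeta_hat (mon [:: lx] * b * mon [:: ly])) _ _ _).
- move=> k p q.
  exact: etrans (congr1 (phi_lin z) (sandwich_lin ncpoly_scalerAr _ _ p q k)) (Plin _ _ _).
- move=> k p q.
  exact: etrans (congr1 (zeta_hat) (sandwich_lin ncpoly_scalerAr _ _ p q k)) (Zlin _ _ _).
move=> u; rewrite (mon_cat [:: lx] u) (mon_cat (lx :: u) [:: ly]) cats1 rcons_cons.
rewrite phi_lin_mon Zmon -phi_zeta; last by rewrite /h1 /= last_rcons.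
by apply: phi_const => //; right; rewrite /center /=; lra.
Qed.

Lemma phi_lin_reg (a c : ncpoly) (z : C) : slit z -> is_reg a c ->
  phi_lin z a = zeta_hat c.
Proof.
move=> sz [n [p [ph -> ->]]]; rewrite -(phi_lin_h0 sz (ph 0%N 0%N)).
pose G i j := shuffle (p i j) (shuffle (shuffle_exp (mon [:: lx]) i)
                                        (shuffle_exp (mon [:: ly]) j)).
have T i j : phi_lin z (G i j) = phi_lin z (p i j) * ((i == 0%N)%:R * (j == 0%N)%:R).
  by rewrite !phi_lin_shuffle // !phi_lin_shuffle_exp.
have Lsum := @lin_ext_sum C^o (phi^~ z) 'I_n.+1 (index_enum 'I_n.+1).
transitivity (\sum_(i < n.+1) \sum_(j < n.+1) phi_lin z (G i j)).
  exact: etrans (Lsum (fun i => \sum_(j < n.+1) G i j))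
    (eq_bigr _ (fun (i : 'I_n.+1) _ => Lsum (fun j => G i j))).
under eq_bigr do under eq_bigr do rewrite T.
rewrite big_ord_recl [X in _ + X]big1 ?addr0; last first.
  by move=> i _; apply: big1 => j _; rewrite mul0r mulr0.
rewrite big_ord_recl [X in _ + X]big1 ?addr0; last by move=> j _; rewrite !mulr0.
by rewrite !mulr1.
Qed.

Unset Implicit Arguments.

Theorem proposition5 (w : seq letter) (z : C) (hz : slit_plane z) :
  \sum_(i < (size w).+1)
     Li (tau (mon (take i w))) (1 - z)%R * Li (mon (drop i w)) z
  = zeta_hat (reg (mon w)).
Proof.
have sz : slit z by apply/slitP.
have hr : is_reg (mon w) (reg (mon w)).
  by apply: epsilon_spec; apply: is_reg_ex (reg_decomposable_word w).
rewrite -(phi_lin_reg sz hr) phi_lin_mon /phi -dsumE.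
apply: eq_bigr => i _; rewrite tau_mon !Li_mon //.
exact: slit_1m.
Qed.
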